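(* Consider a sequence $(\mathcal{T}_n)_{n=1}^\infty$ of random finite unlabeled rooted trees that converges in the probability fringe sense to a random sin-tree $\mathcal{T} = (\mathcal{T}^0, \mathcal{T}^1, \ldots)$. Write $M_n$ for the number of vertices of $\mathcal{T}_n$ and $M(\mathcal{T}_n)$ for the total weight of a maximal matching on $\mathcal{T}_n$ when the associated system of edge weights is a collection of independent and identically distributed $\mathbb{R}_+$-valued random variables $X_n(e)$ (given $\mathcal{T}_n$, one for each edge $e$ of $\mathcal{T}_n$) with a common distribution $\nu$ that has finite expected value. Then $M_n^{-1} M(\mathcal{T}_n)$ converges in distribution to a constant $c_{\mathcal{T},\nu}$ (depending on the model) as $n \to \infty$.
   Context: Let $\mathbb{T}$ be the countable set of all finite unlabeled rooted trees (isomorphism classes of finite rooted trees, where isomorphisms preserve the root), with the discrete topology. Let $\mathbb{T}_\ast = \mathbb{T} \sqcup \{\ast\}$, where $\ast$ is an adjoined point, with the discrete topology, and give $\mathbb{T}^\infty$ and $\mathbb{T}_\ast^\infty$ the product topologies. For $\mathbf{t} \in \mathbb{T}$ with root $\rho$ and a vertex $v$ at distance $h \ge 0$ from the root, let $(v = v_0, v_1, \ldots, v_h = \rho)$ be the path from $v$ to the root. Let $t_0$ be the subtree rooted at $v_0$ consisting of all vertices whose path to the root passes through $v_0$ and, for $1 \le k \le h$, let $t_k$ be the subtree rooted at $v_k$ consisting of all vertices whose path to the root passes through $v_k$ but not through $v_{k-1}$. Let $\Phi(\mathbf{t}, \cdot)$ be the probability measure on $\mathbb{T}_\ast^\infty$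 that places mass $(\#\mathbf{t})^{-1}$ at each of the sequences $(t_0, t_1, \ldots, t_h, \ast, \ast, \ldots)$ as $v$ ranges over the $\#\mathbf{t}$ vertices of $\mathbf{t}$ (masses are added in case of coincidences). A sequence $(\mathcal{T}_n)$ of random elements of $\mathbb{T}$ converges in the probability fringe sense to a $\mathbb{T}^\infty$-valued random variable $\mathcal{T}$ if the random probability measures $\Phi(\mathcal{T}_n, \cdot)$ on $\mathbb{T}_\ast^\infty$ converge in distribution, in the topology of weak convergence of probability measures on $\mathbb{T}_\ast^\infty$, to the (deterministic) distribution of $\mathcal{T}$. Elements of $\mathbb{T}^\infty$ are called sin-trees. A matching of a graph with edge set $E$ is a subset $S \subseteq E$ such that no two edges in $S$ share a vertex. Given edge weights $\{w(e): e \in E\}$, a matching $S^*$ is maximal if $\sum_{e \in S^*} w(e) \ge \sum_{e \in S} w(e)$ for every matching $S$; the total weight of a maximal matching is $\sum_{e \in S^*} w(e)$. *)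

(* Defs.v *)
From HB Require Import structures.
From mathcomp Require Import all_boot all_order all_algebra generic_quotient.
From mathcomp Require Import all_classical all_reals all_analysis.

Set Implicit Arguments.
Unset Strict Implicit.
Unset Printing Implicit Defensive.

Import Order.TTheory GRing.Theory Num.Theory.
Import numFieldNormedType.Exports.

Local Open Scope classical_set_scope.
Local Open Scope ring_scope.
Local Open Scope quotient_scope.

Record rgraph := RGraph {
  gsize : nat;
  gedges : {set {set 'I_gsize}};
  groot : 'I_gsize }.

Definition rgraph_code (G : rgraph) :
    {n : nat & ({set {set 'I_n}} * 'I_n)%type} :=
  Tagged (fun n => ({set {set 'I_n}} * 'I_n)%type) (gedges G, groot G).

Definition rgraph_decode
    (c : {n : nat & ({set {set 'I_n}} * 'I_n)%type}) : rgraph :=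
  RGraph (tagged c).1 (tagged c).2.

Lemma rgraph_codeK : cancel rgraph_code rgraph_decode.
Proof. by case. Qed.

HB.instance Definition _ := Countable.copy rgraph (can_type rgraph_codeK).

Definition gadj (G : rgraph) : rel 'I_(gsize G) :=
  fun u v => [set u; v]%SET \in gedges G.

(* u :: p is the vertex sequence of a path without repetition from u to v *)
Definition simple_path (G : rgraph) (u v : 'I_(gsize G)) : pred (seq 'I_(gsize G)) :=
  fun p => [&& path (@gadj G) u p, last u p == v & uniq (u :: p)].

Definition is_tree (G : rgraph) : bool :=
  [forall e in gedges G, #|(e : {set 'I_(gsize G)})| == 2]
  && `[< forall u v, exists! p, @simple_path G u v p >].

Record rtree := RTree { rtree_graph :> rgraph; rtreeP : is_tree rtree_graph }.

HB.instance Definition _ := [isSub for rtree_graph].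
HB.instance Definition _ := [Countable of rtree by <:].

Definition rtree_iso : rel rtree := fun G H =>
  `[< exists2 f : 'I_(gsize G) -> 'I_(gsize H), bijective f &
        f (groot G) = groot H /\ forall u v, gadj (f u) (f v) = gadj u v >].

Lemma rtree_iso_refl : reflexive rtree_iso.
Proof. by move=> G; apply/asboolP; exists id => //; exists id. Qed.

Lemma rtree_iso_sym_imp G H : rtree_iso G H -> rtree_iso H G.
Proof.
move=> /asboolP[f [g fK gK] [f0 fE]]; apply/asboolP; exists g; first by exists f.
by split=> [|u v]; [rewrite -f0 fK|rewrite -fE !gK].
Qed.

Lemma rtree_iso_sym : symmetric rtree_iso.
Proof. by move=> G H; apply/idP/idP; exact: rtree_iso_sym_imp. Qed.

Lemma rtree_iso_trans : transitive rtree_iso.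
Proof.
move=> H G K /asboolP[f fb [f0 fE]] /asboolP[g gb [g0 gE]].
apply/asboolP; exists (g \o f); first exact: bij_comp.
by split=> [|u v] /=; [rewrite f0|rewrite gE].
Qed.

Canonical rtree_iso_equiv :=
  EquivRel rtree_iso rtree_iso_refl rtree_iso_sym rtree_iso_trans.

Definition utree : Type := {eq_quot rtree_iso}.
HB.instance Definition _ := Choice.on utree.
HB.instance Definition _ := Quotient.on utree.
HB.instance Definition _ := EqQuotient.on utree.

Definition utree_class (G : rtree) : utree := \pi_utree G.

(* an arbitrary labelled representative of an unlabelled tree *)
Definition utree_repr (t : utree) : rtree := repr t.

Section RootPath.
Variable G : rtree.
Local Notation V := 'I_(gsize G).

Lemma simple_path_uniq (u v : V) p q :
  simple_path u v p -> simple_path u v q -> p = q.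
Proof.
case/andP: (rtreeP G) => _ /asboolP/(_ u v)[r [_ ru]].
by move=> /ru <- /ru <-.
Qed.

Lemma root_path_exists (v : V) : exists p, simple_path v (groot G) p.
Proof.
by case/andP: (rtreeP G) => _ /asboolP/(_ v (groot G))[p [? _]]; exists p.
Qed.

(* the path (v_0, ..., v_h) from v_0 = v to the root v_h *)
Definition root_path (v : V) : seq V := v :: xchoose (root_path_exists v).

(* vertex set of t_k: the path to the root meets v_k but not v_(k-1) *)
Definition stem_set (v : V) (k : nat) : {set V} :=
  [set u | (nth v (root_path v) k \in root_path u)
        && ((0 < k)%N ==> (nth v (root_path v) k.-1 \notin root_path u))]%SET.

Lemma root_pathP (v : V) p : simple_path v (groot G) p -> root_path v = v :: p.
Proof.
by move=> vp; rewrite /root_path (simple_path_uniq (xchooseP _) vp).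
Qed.

Lemma root_path_simple (v : V) : simple_path v (groot G) (behead (root_path v)).
Proof. exact: xchooseP. Qed.

Lemma root_path_uniq (v : V) : uniq (root_path v).
Proof. by case/and3P: (root_path_simple v). Qed.

Lemma root_path_cons (u : V) :
  root_path u = [:: u] /\ u = groot G \/
  exists2 w, gadj u w & root_path u = u :: root_path w.
Proof.
have := root_path_simple u; rewrite {1 2 3}/root_path.
case: (xchoose _) => [|w p] /and3P[/= + /eqP lr].
  by move=> _ _; left.
case/andP=> uw wp /andP[_ pu]; right; exists w => //.
by rewrite (@root_pathP w p)// /simple_path wp lr eqxx.
Qed.

Lemma root_path_nth (v : V) k : (k < size (root_path v))%N ->
  root_path (nth v (root_path v) k) = drop k (root_path v).
Proof.
elim: k v => [|k IHk] v; first by rewrite drop0.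
case: (root_path_cons v) => [[-> _]//|[w _ ->]] /= kw.
by rewrite (set_nth_default w)// IHk.
Qed.

Lemma mem_stem_set (v : V) k : (k < size (root_path v))%N ->
  nth v (root_path v) k \in stem_set v k.
Proof.
move=> kv; rewrite inE mem_head andTb root_path_nth//; apply/implyP.
case: k kv => // k kv _; rewrite -pred_Sn.
have := root_path_uniq v.
rewrite -{1}(cat_take_drop k.+1 (root_path v)) cat_uniq => /and3P[_ + _].
apply: contra => kd; apply/hasP; exists (nth v (root_path v) k) => //.
by rewrite (take_nth v (ltnW kv)) mem_rcons mem_head.
Qed.

End RootPath.

Section Induced.
Variables (G : rgraph) (S : {set 'I_(gsize G)}) (x : 'I_(gsize G)).
Hypothesis xS : x \in S.

(* the subgraph induced by S, rooted at x, on the vertex set 'I_#|S| *)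
Definition induced : rgraph :=
  RGraph [set e : {set 'I_#|S|} | [set enum_val i | i in e]%SET \in gedges G]%SET
         (enum_rank_in xS x).

Lemma induced_adj (i j : 'I_#|S|) :
  @gadj induced i j = gadj (enum_val i) (enum_val j).
Proof. by rewrite /gadj inE imsetU1 imset_set1. Qed.

Lemma induced_is_tree : is_tree G ->
  (forall u, u \in S ->
    connect [rel a b | [&& gadj a b, a \in S & b \in S]] u x) ->
  is_tree induced.
Proof.
move=> /andP[/forall_inP Ge /asboolP Gt] Sx; apply/andP; split.
  apply/forall_inP => e; rewrite inE => /Ge/eqP <-.
  by rewrite card_imset//; exact: enum_val_inj.
apply/asboolP => i j.
have symR : connect_sym [rel a b | [&& gadj a b, a \in S & b \in S]].
  by apply: sym_connect_sym => a b /=; rewrite /gadj finset.setUC andbA andbAC -andbA.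
have ij : connect [rel a b | [&& gadj a b, a \in S & b \in S]] (enum_val i) (enum_val j).
  by apply: (connect_trans (Sx _ (enum_valP i))); rewrite symR Sx// enum_valP.
have [p ip /eqP] : exists2 p, path (@gadj induced) i p & last i p == j.
  case/connectP: ij => p pp lp.
  exists (map (enum_rank_in xS) p); last first.
    have := congr1 (enum_rank_in xS) lp; rewrite enum_valK_in => ->.
    by rewrite -[i in last i](enum_valK_in xS) last_map.
  rewrite -[i in path _ i](enum_valK_in xS) path_map.
  apply: sub_path pp => a b /and3P[ab aS bS] /=.
  by rewrite induced_adj !enum_rankK_in.
case/shortenP: ip => q iq uq _ lq; exists q; split.
  by rewrite /simple_path iq lq eqxx.
move=> r /and3P[ir /eqP lr ur].
apply: (@inj_map _ _ (@enum_val _ S)); first exact: enum_val_inj.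
have sp s : path (@gadj induced) i s -> last i s = j -> uniq (i :: s) ->
    simple_path (enum_val i) (enum_val j) (map enum_val s).
  move=> is_ ls us; apply/and3P; split.
  - by rewrite path_map; apply: sub_path is_ => a b /=; rewrite induced_adj.
  - by rewrite last_map ls.
  - by rewrite -(map_inj_uniq (@enum_val_inj _ S)) in us.
have [t [_ tu]] := Gt (enum_val i) (enum_val j).
by rewrite -(tu _ (sp _ iq lq uq)) -(tu _ (sp _ ir lr ur)).
Qed.

End Induced.

Section Spine.
Variable G : rtree.
Local Notation V := 'I_(gsize G).

Lemma stem_set_is_tree (v : V) (k : 'I_(size (root_path v))) :
  is_tree (induced (mem_stem_set (ltn_ord k))).
Proof.
apply: induced_is_tree; first exact: rtreeP.
set w := nth _ _ _ => u; have [n] := ubnP (size (root_path u)).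
elim: n u => // n IHn u; rewrite ltnS => un uS.
case: (root_path_cons u) => [[up _]|[z uz up]].
  by move: (uS); rewrite finset.in_set up mem_seq1 => /andP[/eqP <- _]; exact: connect0.
have [<-|uw] := eqVneq u w; first exact: connect0.
have zS : z \in stem_set v k.
  move: uS; rewrite !finset.in_set -/w up !in_cons eq_sym (negbTE uw) /= => /andP[-> /implyP h].
  by apply/implyP => /h; rewrite negb_or => /andP[].
apply: connect_trans (IHn z _ zS); last by move: un; rewrite up.
by apply: connect1; rewrite /= uz uS zS.
Qed.

(* the tree t_k, rooted at v_k, for 0 <= k <= h *)
Definition stem_tree (v : V) (k : 'I_(size (root_path v))) : rtree :=
  RTree (stem_set_is_tree k).

(* the sequence (t_0, ..., t_h, *, *, ...), with None in the role of * *)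
Definition spine (v : V) : nat -> option utree :=
  fun k => omap (fun i : 'I_(size (root_path v)) => utree_class (stem_tree i)) (insub k).

End Spine.

Lemma single_is_tree : is_tree (@RGraph 1 finset.set0 ord0).
Proof.
apply/andP; split; first by apply/forall_inP => e; rewrite finset.in_set0.
apply/asboolP => u v; exists [::]; split; first by rewrite /simple_path /= !ord1.
move=> [|w p]//; rewrite /simple_path /= /gadj /= finset.in_set0 /=.
by [].
Qed.

HB.instance Definition _ := isPointed.Build utree (utree_class (RTree single_is_tree)).

(* the alias carries the pointed topology that discrete_topology utree lacks *)
Definition tree_space : Type := discrete_topology utree.
HB.instance Definition _ := DiscreteTopology.on tree_space.
HB.instance Definition _ := Pointed.copy tree_space utree.

(* sequences in utree, and in utree with an adjoined point None, with the
   product of the discrete topologies *)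
Definition sin_tree : Type := {ptws nat -> tree_space}.
HB.instance Definition _ := Topological.on sin_tree.
HB.instance Definition _ := Pointed.on sin_tree.

Definition fringe_seq : Type := {ptws nat -> discrete_topology (option utree)}.
HB.instance Definition _ := Topological.on fringe_seq.
HB.instance Definition _ := Pointed.on fringe_seq.

Definition borel (X : ptopologicalType) := g_sigma_algebraType (@open X).
HB.instance Definition _ (X : ptopologicalType) := Measurable.on (borel X).

Definition sin_tree_incl (s : sin_tree) : fringe_seq := fun k => Some (s k).

Lemma continuous_ptws (X : topologicalType) (I : Type) (K : topologicalType)
    (h : X -> {ptws I -> K}) :
  (forall i, continuous (fun x => h x i)) -> continuous h.
Proof.
move=> hc x; apply/cvg_sup => i U [V] [[W oW <-] Whx] WU.
apply: (filterS WU); apply: (hc i x); exact: open_nbhs_nbhs.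
Qed.

Lemma sin_tree_incl_continuous : continuous sin_tree_incl.
Proof.
apply: continuous_ptws => k s A /principal_filterP nA.
have := @proj_continuous _ (fun=> tree_space) k s [set t | A (Some t)].
by apply; apply/principal_filterP.
Qed.

Lemma sin_tree_incl_measurable :
  measurable_fun [set: borel sin_tree]
    (sin_tree_incl : borel sin_tree -> borel fringe_seq).
Proof.
apply: measurability; first by [].
move=> _ [A oA <-]; rewrite setTI; apply: sub_sigma_algebra.
by move: A oA; apply/continuousP; exact: sin_tree_incl_continuous.
Qed.

HB.instance Definition _ := isMeasurableFun.Build _ _ _ _
  (sin_tree_incl : borel sin_tree -> borel fringe_seq) sin_tree_incl_measurable.

Section Phi.
Variables (R : realType) (t : utree).
Local Open Scope ereal_scope.
Local Notation G := (utree_repr t).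

Definition Phi (A : set (borel fringe_seq)) : \bar R :=
  ((gsize G)%:R^-1)%:E * \sum_(v < gsize G) \d_(spine v : borel fringe_seq) A.

Let Phi0 : Phi set0 = 0.
Proof. by rewrite /Phi big1 ?mule0// => v _; rewrite measure0. Qed.

Let Phi_ge0 A : 0 <= Phi A.
Proof. by rewrite /Phi mule_ge0 ?sume_ge0// lee_fin invr_ge0. Qed.

Let Phi_sigma_additive : semi_sigma_additive Phi.
Proof.
have r0 : (0 <= (gsize G)%:R^-1 :> R)%R by rewrite invr_ge0.
pose D (k : nat) : {measure set (borel fringe_seq) -> \bar R} :=
  @dirac _ (borel fringe_seq) (spine (odflt (groot G) (insub k))) R.
suff -> : Phi = mscale (NngNum r0) (msum D (gsize G)).
  exact: measure_semi_sigma_additive.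
apply/funext => A; rewrite /Phi /mscale /msum /=; congr (_ * _).
by apply: eq_bigr => v _; rewrite /D valK.
Qed.

HB.instance Definition _ := isMeasure.Build _ _ _ Phi
  Phi0 Phi_ge0 Phi_sigma_additive.

Let Phi_setT : Phi [set: _] = 1.
Proof.
rewrite /Phi; under eq_bigr do rewrite diracT.
rewrite sumEFin -EFinM sumr_const card_ord mulVf// pnatr_eq0.
by case: (groot G) => m; case: (gsize G).
Qed.

HB.instance Definition _ := Measure_isProbability.Build _ _ _ Phi Phi_setT.

End Phi.

Definition sin_tree_law (R : realType) d (Omega : measurableType d)
    (P : probability Omega R) (S : {RV P >-> borel sin_tree}) :
    probability (borel fringe_seq) R :=
  distribution (distribution P S)
    (sin_tree_incl : {mfun borel sin_tree >-> borel fringe_seq}).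

Definition bounded_continuous (R : realType) (X : topologicalType) : Type :=
  {f : X -> R | continuous f /\ bounded_fun f}.
HB.instance Definition _ (R : realType) (X : topologicalType) :=
  gen_eqMixin (bounded_continuous R X).
HB.instance Definition _ (R : realType) (X : topologicalType) :=
  gen_choiceMixin (bounded_continuous R X).

(* Borel probability measures on X with the topology of weak convergence: the
   coarsest one making mu |-> \int f dmu continuous for all bounded continuous f *)
Definition weak_prob (R : realType) (X : ptopologicalType) : Type :=
  @initial_topology (probability (borel X) R) {ptws bounded_continuous R X -> R}
    (fun mu f => \int[mu]_x sval f x).
HB.instance Definition _ (R : realType) (X : ptopologicalType) :=
  Topological.on (weak_prob R X).

(* convergence in distribution to a deterministic limit x; the variables Y n may
   live on different probability spaces *)
Definition cvg_in_distribution_cst (R : realType) (X : topologicalType)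
    (d : nat -> measure_display) (Omega : forall n, measurableType (d n))
    (P : forall n, probability (Omega n) R)
    (Y : forall n, Omega n -> X) (x : X) : Prop :=
  forall f : X -> R, continuous f -> bounded_fun f ->
    \int[P n]_w f (Y n w) @[n --> \oo] --> f x.

Definition cvg_fringe (R : realType)
    (d : nat -> measure_display) (Omega : forall n, measurableType (d n))
    (P : forall n, probability (Omega n) R)
    (T : forall n, Omega n -> utree)
    (d0 : measure_display) (Omega0 : measurableType d0)
    (P0 : probability Omega0 R) (S : {RV P0 >-> borel sin_tree}) : Prop :=
  @cvg_in_distribution_cst R (weak_prob R fringe_seq) d Omega P
    (fun n w => Phi R (T n w) : probability (borel fringe_seq) R) (sin_tree_law S).

Definition matching (G : rgraph) (S : {set {set 'I_(gsize G)}}) : bool :=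
  (S \subset gedges G) &&
  [forall e in S, forall f in S, (e != f) ==> [disjoint e & f]].

Definition maximal_matching (R : realType) (G : rgraph)
    (w : {set 'I_(gsize G)} -> R) (S : {set {set 'I_(gsize G)}}) : Prop :=
  matching S /\
  forall S' : {set {set 'I_(gsize G)}}, matching S' ->
    \sum_(e in S') w e <= \sum_(e in S) w e.

Definition matching_weight (R : realType) (G : rgraph)
    (w : {set 'I_(gsize G)} -> R) : R :=
  \sum_(e in [arg max_(S > finset.set0 : {set {set 'I_(gsize G)}} | matching S) \sum_(e in S) w e]%O) w e.

Lemma matching0 (G : rgraph) : @matching G finset.set0.
Proof.
by rewrite /matching finset.sub0set; apply/forall_inP => e; rewrite finset.in_set0.
Qed.

Lemma matching_weightP (R : realType) (G : rgraph) (w : {set 'I_(gsize G)} -> R) :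
  exists2 S, maximal_matching w S & matching_weight w = \sum_(e in S) w e.
Proof.
rewrite /matching_weight; case: arg_maxP => [|S mS maxS]; first exact: matching0.
by exists S => //; split=> // S' /maxS.
Qed.

(* Given T, the weights are independent with law nu. The weight X t e matters
   only on the event {T = t} and for e an edge of the representative of t; the
   product formula over all families A of Borel sets is the conditional
   independence and identity of law given T, which is discrete. *)
Definition cond_iid_weights (R : realType) d (Omega : measurableType d)
    (P : probability Omega R) (nu : probability (measurableTypeR R) R)
    (T : Omega -> utree)
    (X : forall t : utree, {set 'I_(gsize (utree_repr t))} -> Omega -> R) : Prop :=
  forall t : utree,
    let E := gedges (utree_repr t) in
    let Tt := T @^-1` [set t] in
    (forall e, e \in E ->
       measurable_fun Tt (X t e) /\ forall w, Tt w -> 0 <= X t e w) /\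
    forall A : {set 'I_(gsize (utree_repr t))} -> set R,
      (forall e, measurable (A e)) ->
      (P (Tt `&` [set w | forall e, e \in E -> A e (X t e w)]) =
       P Tt * \prod_(e in E) nu (A e))%E.

(* Main.v *)
Require Import Defs.
From HB Require Import structures.
From mathcomp Require Import all_boot all_order all_algebra.
From mathcomp Require Import all_classical all_reals all_analysis measurable_realfun.
From mathcomp Require Import ring lra.

(* For a vertex [v] let [D v] be its set of descendants (with [v]) and let
   [M U] be the maximal weight of a matching inside the vertex set [U].  The
   gain [h v = M (D v) - M (D v minus v)] depends only on the fringe subtree at
   [v] and its weights; peeling the vertices off from the root downwards gives
   [M V = sum over v of h v].
   Replace each weight [x] by [phi x] with [phi] simple and L1-close to the
   identity: since [M] is 1-Lipschitz for the l1 norm of the weights, the cost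
   per vertex is at most [delta = int |x - phi x| dnu], and expectations become
   iterated finite sums.  With weights bounded by [K], the mean gain is a bounded
   function of the fringe subtree, so its average over the vertices converges by
   fringe convergence to a constant [c_phi], and the variance of [M] given the
   tree is at most (number of edges) * (2 K)^2, which vanishes after division by
   the squared number of vertices because the limit tree is infinite.
   Finally [c] is the limit of [c_phi] as [delta] tends to 0; the [c_phi] are
   Cauchy because they all approximate the same random variables. *)

Set Implicit Arguments.
Unset Strict Implicit.
Unset Printing Implicit Defensive.

Import Order.TTheory GRing.Theory Num.Theory.
Import numFieldNormedType.Exports.

Local Open Scope ring_scope.

(** * Maximal matchings inside a vertex set *)

Section MaxMatching.
Variables (R : realType) (G : Defs.rgraph).
Local Notation V := 'I_(gsize G).
Implicit Types (U A B : {set V}) (w : {set V} -> R) (S : {set {set V}}).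

Definition matching_in U S :=
  matching S && [forall e in S, (e : {set V}) \subset U].

(** The base value [0] is the weight of the empty matching, so it does no harm for weights of any
    sign. *)
Definition max_matching U w : R :=
  \big[Num.max/0]_(S | matching_in U S) \sum_(e in S) w e.

Lemma matching_inP U S : reflect
  [/\ {subset S <= gedges G}, {in S &, forall e f : {set V}, e != f -> [disjoint e & f]} &
      {in S, forall e : {set V}, e \subset U}]
  (matching_in U S).
Proof.
apply: (iffP idP) => [/andP[/andP[SE /forall_inP Sd] /forall_inP SU]|[SE Sd SU]].
  split => //; first exact/fintype.subsetP.
  by move=> e f eS fS; move/forall_inP: (Sd e eS) => h; exact/implyP/h.
apply/andP; split; last exact/forall_inP.
apply/andP; split; first exact/fintype.subsetP.
by apply/forall_inP => e eS; apply/forall_inP => f fS; apply/implyP; exact: Sd.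
Qed.

Lemma matching_in0 U : matching_in U finset.set0.
Proof. by apply/matching_inP; split => [e|e f|e]; rewrite finset.in_set0. Qed.

Lemma matching_in_sub U A S S' : S' \subset S -> {in S', forall e : {set V}, e \subset A} ->
  matching_in U S -> matching_in A S'.
Proof.
move=> /fintype.subsetP SS SA /matching_inP[SE Sd SU]; apply/matching_inP; split => //.
  by move=> e /SS /SE.
by move=> e f /SS eS /SS fS; exact: Sd.
Qed.

Lemma max_matching_ge U w S : matching_in U S -> \sum_(e in S) w e <= max_matching U w.
Proof. by move=> US; rewrite /max_matching (bigmax_sup S). Qed.

Lemma max_matching_ge0 U w : 0 <= max_matching U w.
Proof. by rewrite -[leLHS](@big_set0 _ _ +%R _ w) max_matching_ge// matching_in0. Qed.

Lemma max_matching_le U w b :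
  (forall S, matching_in U S -> \sum_(e in S) w e <= b) -> max_matching U w <= b.
Proof.
move=> h; apply: bigmax_le => //.
by have := h _ (matching_in0 U); rewrite big_set0.
Qed.

Lemma max_matching_attained U w :
  exists2 S, matching_in U S & max_matching U w = \sum_(e in S) w e.
Proof.
have [S US maxS] := @arg_maxP _ _ _ finset.set0 (matching_in U) (fun S => \sum_(e in S) w e)
  (matching_in0 U).
by exists S => //; apply/eqP; rewrite eq_le max_matching_ge// max_matching_le.
Qed.

Lemma matching_weightE w : matching_weight w = max_matching [set: V]%SET w.
Proof.
have [S [mS maxS] ->] := matching_weightP w; apply/eqP; rewrite eq_le.
rewrite max_matching_ge ?max_matching_le//=.
- by move=> S' /andP[mS' _]; exact: maxS.
- by rewrite /matching_in mS; apply/forall_inP => e _; exact: finset.subsetT.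
Qed.

(** An optimal matching for [w] also competes for [w'], and its two weights differ by at most the l1
    distance over the edges inside [U]. *)
Lemma max_matching_lip U w w' :
  `|max_matching U w - max_matching U w'|
  <= \sum_(e in gedges G | (e : {set V}) \subset U) `|w e - w' e|.
Proof.
wlog suff lip : w w' / max_matching U w - max_matching U w' <=
    \sum_(e in gedges G | (e : {set V}) \subset U) `|w e - w' e|.
  rewrite ler_norml lip andbT lerNl opprB.
  by rewrite (eq_bigr _ (fun e _ => distrC (w e) (w' e))).
rewrite lerBlDr; apply: max_matching_le => S US.
apply: (@le_trans _ _ (\sum_(e in S) `|w e - w' e| + \sum_(e in S) w' e)).
  rewrite -big_split/=; apply: ler_sum => e _.
  by rewrite -lerBlDr ler_norm.
apply: lerD; last exact: max_matching_ge.
move/matching_inP : US => [SE _ SU].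
rewrite [leRHS](bigID (fun e => e \in S))/=.
rewrite [X in _ <= X + _](eq_bigl (fun e => e \in S)).
  by rewrite lerDl sumr_ge0.
by move=> e; case: (boolP (e \in S)) => [eS|]; rewrite ?andbF// SE ?SU.
Qed.

Lemma eq_max_matching U w w' :
  (forall e, e \in gedges G -> (e : {set V}) \subset U -> w e = w' e) ->
  max_matching U w = max_matching U w'.
Proof.
move=> ww; apply/eqP; rewrite -subr_eq0 -normr_le0.
apply: (le_trans (max_matching_lip _ _ _)).
by rewrite big1// => e /andP[eE eU]; rewrite ww// subrr normr0.
Qed.

Lemma max_matching_mono A U w : A \subset U -> max_matching A w <= max_matching U w.
Proof.
move=> AU; apply: max_matching_le => S AS; apply: max_matching_ge.
apply: (matching_in_sub (subxx S) _ AS) => e eS.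
by apply: fintype.subset_trans AU; move/matching_inP: AS => [_ _]; exact.
Qed.

(* A matching has at most one edge at [v]. *)
Lemma max_matching_setD1 U w (v : V) (K : R) : 0 <= K ->
  (forall e, e \in gedges G -> w e <= K) ->
  max_matching U w <= max_matching (U :\ v)%SET w + K.
Proof.
move=> K0 wK; apply: max_matching_le => S US.
rewrite (bigID (fun e : {set V} => v \notin e))/=; apply: lerD.
  rewrite (eq_bigl (fun e => e \in [set e in S | v \notin e]%SET)); last first.
    by move=> e; rewrite finset.in_set.
  apply: max_matching_ge; apply: (matching_in_sub _ _ US).
    by apply/fintype.subsetP => e; rewrite inE => /andP[].
  move=> e; rewrite inE => /andP[eS ve]; rewrite subsetD1 ve andbT.
  by move: US => /matching_inP[_ _]; exact.
move: US => /matching_inP[SE Sd _].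
have [[e /andP[eS /negPn ve]]|nS] := pselect (exists e, (e \in S) && ~~ (v \notin e)); last first.
  by rewrite big1// => e Se; case: nS; exists e.
rewrite (big_pred1 e) ?wK ?SE// => f; apply/andP/eqP => [[fS /negPn vf]|->]; last first.
  by rewrite eS negbK.
apply/eqP; apply: contraT => /(Sd _ _ fS eS) /pred0P /(_ v) /=.
by rewrite vf ve.
Qed.

(** No edge straddles [A] and [B], so the matchings inside the union are exactly the unions of a
    matching inside [A] and one inside [B]. *)
Lemma max_matchingU A B w :
  {in gedges G, forall e : {set V}, #|e| = 2} ->
  [disjoint A & B] -> {in A & B, forall a b, ~~ gadj a b} ->
  max_matching (A :|: B)%SET w = max_matching A w + max_matching B w.
Proof.
move=> G2 AB nAB; apply/eqP; rewrite eq_le; apply/andP; split.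
  apply: max_matching_le => S US.
  rewrite (bigID (fun e : {set V} => e \subset A))/=; apply: lerD.
    rewrite (eq_bigl (fun e => e \in [set e in S | e \subset A]%SET)); last first.
      by move=> e; rewrite finset.in_set.
    apply: max_matching_ge; apply: (matching_in_sub _ _ US).
      by apply/fintype.subsetP => e; rewrite inE => /andP[].
    by move=> e; rewrite inE => /andP[].
  rewrite (eq_bigl (fun e => e \in [set e in S | ~~ (e \subset A)]%SET)); last first.
    by move=> e; rewrite finset.in_set.
  apply: max_matching_ge; apply: (matching_in_sub _ _ US).
    by apply/fintype.subsetP => e; rewrite inE => /andP[].
  move: US => /matching_inP[SE _ SU] e; rewrite inE => /andP[eS eA].
  have eE := SE _ eS; have /eqP/cards2P[a [b [ab eab]]] := G2 _ eE.
  move: (SU _ eS) eA; rewrite eab !finset.subUset !finset.sub1set !inE.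
  have nab : ~~ ((a \in A) && (b \in B)).
    by apply/negP => /andP[aA bB]; have := nAB _ _ aA bB; rewrite /gadj -eab eE.
  have nba : ~~ ((b \in A) && (a \in B)).
    apply/negP => /andP[aA bB]; have := nAB _ _ aA bB.
    by rewrite /gadj finset.setUC -eab eE.
  move: nab nba.
  by case: (a \in A); case: (b \in A); case: (a \in B); case: (b \in B).
have [S1 AS1 ->] := max_matching_attained A w.
have [S2 BS2 ->] := max_matching_attained B w.
move: AS1 BS2 => /matching_inP[S1E S1d S1A] /matching_inP[S2E S2d S2B].
have dis e f : e \in S1 -> f \in S2 -> [disjoint e & f].
  move=> eS fS; apply: (disjointWl (S1A _ eS)); apply: (disjointWr (S2B _ fS)) => //.
(* A common edge would be disjoint from itself, hence empty, against its cardinality 2. *)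
have S12 : [disjoint S1 & S2].
  apply/pred0P => e /=; apply/negP => /andP[e1 e2].
  have := dis _ _ e1 e2; rewrite -setI_eq0 finset.setIid -cards_eq0 G2//.
  exact: S1E.
rewrite -bigU// (eq_bigl (fun e => e \in (S1 :|: S2)%SET)); last first.
  by move=> e; rewrite finset.in_setU.
apply: max_matching_ge; apply/matching_inP; split.
- by move=> e; rewrite inE => /orP[/S1E|/S2E].
- move=> e f; rewrite !inE => /orP[e1|e2] /orP[f1|f2] ef.
  + exact: S1d.
  + exact: dis.
  + by rewrite disjoint_sym; exact: dis.
  + exact: S2d.
- move=> e; rewrite inE => /orP[/S1A|/S2B] h; apply: (fintype.subset_trans h).
    exact: finset.subsetUl.
  exact: finset.subsetUr.
Qed.

End MaxMatching.

(** * Matchings along an adjacency-preserving injection *)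

Section Transfer.
Variables (R : realType) (H G : Defs.rgraph) (h : 'I_(gsize H) -> 'I_(gsize G)).
Hypothesis h_inj : injective h.
Hypothesis h_adj : forall u v, gadj (h u) (h v) = gadj u v.
Hypothesis H2 : {in gedges H, forall e : {set 'I_(gsize H)}, #|e| = 2}.
Hypothesis G2 : {in gedges G, forall e : {set 'I_(gsize G)}, #|e| = 2}.
Implicit Types (U : {set 'I_(gsize H)}).

Lemma edge_imset (e : {set 'I_(gsize H)}) : e \in gedges H -> h @: e \in gedges G.
Proof.
move=> eE; have /eqP/cards2P[a [b [_ eab]]] := H2 eE.
by rewrite eab imsetU1 imset_set1 -[_ \in _]/(gadj _ _) h_adj /gadj -eab.
Qed.

Lemma edge_imset_inv U (e : {set 'I_(gsize G)}) : e \in gedges G -> e \subset h @: U ->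
  exists f : {set 'I_(gsize H)}, [/\ f \in gedges H, f \subset U & e = h @: f].
Proof.
move=> eE; have /eqP/cards2P[a [b [_ eab]]] := G2 eE.
rewrite eab finset.subUset !finset.sub1set => /andP[/imsetP[a' aU aE] /imsetP[b' bU bE]].
exists [set a'; b']%SET; rewrite finset.subUset !finset.sub1set aU bU; split => //.
  by rewrite -[_ \in _]/(gadj _ _) -h_adj -aE -bE /gadj -eab.
by rewrite imsetU1 imset_set1 aE bE.
Qed.

(** Taking images under [h] is a weight-preserving bijection between the matchings inside [U] and
    those inside [h @: U]. *)
Lemma max_matching_imset U (w : {set 'I_(gsize G)} -> R) :
  max_matching (h @: U) w = max_matching U (fun e => w (h @: e)).
Proof.
have hh : injective (fun e : {set 'I_(gsize H)} => h @: e) by exact: imset_inj.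
have hd (e f : {set 'I_(gsize H)}) : [disjoint h @: e & h @: f] = [disjoint e & f].
  by rewrite -!setI_eq0 -imsetI ?imset_eq0//; move=> ? ? _ _ /h_inj.
apply/eqP; rewrite eq_le; apply/andP; split; apply: max_matching_le => S /matching_inP[SE Sd SU].
  pose S' := [set e : {set 'I_(gsize H)} | h @: e \in S]%SET.
  have SS' : S = [set h @: (e : {set 'I_(gsize H)}) | e in S']%SET.
    apply/finset.setP => e; apply/idP/imsetP => [eS|[f + ->]]; last by rewrite finset.in_set.
    have [f [_ _ ef]] := edge_imset_inv (SE _ eS) (SU _ eS).
    by exists f => //; rewrite finset.in_set -ef.
  rewrite SS' big_imset/=; last by move=> ? ? _ _ /hh.
  apply: max_matching_ge.
  have S'E (e : {set 'I_(gsize H)}) : e \in S' -> e \in gedges H /\ e \subset U.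
    rewrite finset.in_set => eS.
    by have [f [fE fU /hh ->]] := edge_imset_inv (SE _ eS) (SU _ eS).
  apply/matching_inP; split => [e /S'E[]//|e f|e /S'E[]//].
  rewrite !finset.in_set => eS fS ef.
  by rewrite -hd; apply: Sd => //; apply: contra ef => /eqP/hh ->.
rewrite -(big_imset (h := fun e : {set 'I_(gsize H)} => h @: e) w)/=; last by move=> ? ? _ _ /hh.
apply: max_matching_ge; apply/matching_inP; split.
- by move=> _ /imsetP[e /SE eE ->]; exact: edge_imset.
- move=> _ _ /imsetP[e eS ->] /imsetP[f fS ->] ef.
  by rewrite hd; apply: Sd => //; apply: contra ef => /eqP ->.
- by move=> _ /imsetP[e /SU eU ->]; exact: imsetS.
Qed.

End Transfer.

(** * Parents, descendants and the decomposition into gains *)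

Section TreeCombinatorics.
Variable G : rtree.
Local Notation V := 'I_(gsize G).
Implicit Types (u v a b : V) (U : {set V}).

Lemma tree_edge_card : {in gedges G, forall e : {set V}, #|e| = 2}.
Proof. by move=> e eE; have /andP[/forall_inP/(_ e eE)/eqP] := rtreeP G. Qed.

Lemma gadj_sym : symmetric (@gadj G).
Proof. by move=> a b; rewrite /gadj finset.setUC. Qed.

Lemma gadj_irr a : ~~ gadj a a.
Proof. by apply/negP => /tree_edge_card; rewrite finset.setUid cards1. Qed.

Lemma root_path_head v : root_path v = v :: behead (root_path v).
Proof. by []. Qed.

Lemma mem_root_path v : v \in root_path v.
Proof. by rewrite root_path_head mem_head. Qed.

Lemma root_path_adj a b : gadj a b -> a \notin root_path b ->
  root_path a = a :: root_path b.
Proof.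
move=> ab ab'; apply: root_pathP; have /and3P[p1 p2 p3] := root_path_simple b.
by apply/and3P; split; [rewrite /= ab p1|rewrite /= p2|rewrite cons_uniq ab' root_path_uniq].
Qed.

(** Of two adjacent vertices one is the parent of the other: if [a] lies on the root path of [b],
    then the root path of [a] is a proper suffix of it and avoids [b]. *)
Lemma gadj_root_path a b : gadj a b ->
  root_path a = a :: root_path b \/ root_path b = b :: root_path a.
Proof.
move=> ab; have [aPb|] := boolP (a \in root_path b); last by left; exact: root_path_adj.
right; apply: root_path_adj; first by rewrite gadj_sym.
have ab' : a != b by apply: contraTneq ab => ->; exact: gadj_irr.
have k_lt : (index a (root_path b) < size (root_path b))%N by rewrite index_mem.
have := root_path_nth k_lt; rewrite nth_index// => ->.
have := root_path_uniq b; rewrite root_path_head /= (negbTE (_ : b != a)) 1?eq_sym//=.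
case/andP => + _; apply: contra; exact: mem_drop.
Qed.

Lemma root_path_size_trans u v : u \in root_path v -> u != v ->
  (size (root_path u) < size (root_path v))%N.
Proof.
move=> uv; have k_lt : (index u (root_path v) < size (root_path v))%N by rewrite index_mem.
move: (root_path_nth k_lt); rewrite nth_index// => -> nuv.
rewrite size_drop root_path_head /= eq_sym (negbTE nuv) subSS ltnS.
exact: leq_subr.
Qed.

(** Every edge joins some vertex to its parent. At the root the default of [nth] gives a singleton,
    which is harmless since only a covering of the edges is wanted. *)
Lemma card_tree_edges : (#|gedges G| <= gsize G)%N.
Proof.
rewrite -[leqRHS]card_ord -cardsT.
apply: leq_trans (leq_imset_card (fun v : V => [set v; nth v (root_path v) 1]%SET) _).
apply: subset_leq_card; apply/fintype.subsetP => e eE.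
have /eqP/cards2P[a [b [ab eab]]] := tree_edge_card eE.
have : gadj a b by rewrite /gadj -eab.
move=> /gadj_root_path[abP|baP]; apply/imsetP.
  by exists a => //; rewrite abP eab.
by exists b => //; rewrite baP eab finset.setUC.
Qed.

Definition descendants v : {set V} := [set u | v \in root_path u]%SET.

Lemma in_descendants u v : (u \in descendants v) = (v \in root_path u).
Proof. by rewrite finset.in_set. Qed.

Let in_vsetE :=
  (finset.in_setI, finset.in_setD1, finset.in_setD, in_descendants).

Variable R : realType.
Implicit Type w : {set V} -> R.

Definition root_gain v w : R :=
  max_matching (descendants v) w - max_matching (descendants v :\ v)%SET w.

(** The sum telescopes when vertices are removed one at a time, each before its descendants. *)
Lemma sum_root_gain w : max_matching [set: V]%SET w = \sum_v root_gain v w.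
Proof.
(* The induction runs over the sets closed under descendants; each step removes a vertex [v] of [U]
   nearest to the root. *)
suff gain_down U : {in U, forall v, descendants v \subset U} ->
    max_matching U w = \sum_(v in U) root_gain v w.
  rewrite gain_down => [|v _]; last exact: finset.subsetT.
  by apply: eq_bigl => v; rewrite finset.in_setT.
have [n] := ubnP #|U|; elim: n U => // n IHn U; rewrite ltnS => Un Ud.
have [->|[v0 v0U]] := finset.set_0Vmem U.
  rewrite big_set0; apply/eqP; rewrite eq_le max_matching_ge0 andbT.
  apply: max_matching_le => S /matching_inP[SE _ S0]; rewrite big1// => e eS.
  have := S0 _ eS; rewrite finset.subset0 => /eqP e0.
  by have := tree_edge_card (SE _ eS); rewrite e0 cards0.
have [v vU vmin] : exists2 v, v \in U &
    forall u, u \in U -> (size (root_path v) <= size (root_path u))%N.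
  by case: (arg_minnP (fun v => size (root_path v)) v0U) => v vU h; exists v.
have sepv (A : {set V}) : A \subset U -> max_matching A w =
    max_matching (A :&: descendants v)%SET w + max_matching (A :\: descendants v)%SET w.
  move=> /fintype.subsetP AU; rewrite -{1}(finset.setID A (descendants v)).
  apply: max_matchingU; first exact: tree_edge_card.
    by apply/pred0P => x /=; rewrite !in_vsetE; case: (v \in root_path x); rewrite ?andbF.
  move=> a b; rewrite !in_vsetE => /andP[_ va] /andP[vb bA].
  (* An edge leaving [descendants v] must join [v] to its parent, which is closer to the root and so
     cannot lie in [U]. *)
  apply/negP => /gadj_root_path[] ab.
    move: va; rewrite ab in_cons (negbTE vb) orbF => /eqP va.
    by have := vmin b (AU _ bA); rewrite va ab ltnn.
  by move: vb; rewrite ab in_cons va orbT.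
rewrite (big_setD1 v)//= -IHn.
- rewrite sepv// [max_matching (U :\ v) _]sepv ?finset.subsetDl// addrA; congr (_ + _).
    rewrite /root_gain (_ : U :&: _ = descendants v)%SET; last first.
      by apply/finset.setIidPr; exact: Ud.
    rewrite (_ : (U :\ v) :&: _ = descendants v :\ v)%SET ?subrK//.
    apply/finset.setP => x; rewrite !in_vsetE -andbA.
    case: (eqVneq x v) => //= _.
    by rewrite andb_idl// => vx; apply: (fintype.subsetP (Ud _ vU)); rewrite inE.
  congr max_matching; apply/finset.setP => x; rewrite !in_vsetE.
  by case: (eqVneq x v) => [->|]; rewrite ?mem_root_path ?andbF.
- by move: Un; rewrite (finset.cardsD1 v U) vU.
(* The set stays closed: if [v] descended from another [u] in [U], then [u] would be closer to the
   root. *)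
- move=> u; rewrite !in_vsetE => /andP[uv uU].
  apply/fintype.subsetP => x xu.
  rewrite !in_vsetE (fintype.subsetP (Ud _ uU))// andbT.
  apply/negP => /eqP xv.
  move: xu; rewrite xv in_descendants => /root_path_size_trans/(_ uv).
  by rewrite ltnNge vmin.
Qed.

End TreeCombinatorics.

(** * Iterated finite means *)

Section IteratedMean.
Variables (R : realType) (vs : seq R) (p : R -> R).
Hypothesis p_ge0 : forall y, 0 <= p y.
Hypothesis p_sum : \sum_(y <- vs) p y = 1.

Definition upd (J : eqType) (w : J -> R) (e : J) (y : R) : J -> R :=
  fun j => if j == e then y else w j.

Lemma updC (J : eqType) (w : J -> R) e e' y y' : e != e' ->
  upd (upd w e y) e' y' = upd (upd w e' y') e y.
Proof.
move=> ee'; apply/funext => j; rewrite /upd.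
by case: (eqVneq j e') => // ->; rewrite eq_sym (negbTE ee').
Qed.

Lemma upd_id (J : eqType) (w : J -> R) e y y' : upd (upd w e y) e y' = upd w e y'.
Proof. by apply/funext => j; rewrite /upd; case: eqP. Qed.

(** The expectation of [F] when the coordinates in [s], taken without repetition, are independent
    with masses [p] on [vs] and the others are frozen at [w]. *)
Fixpoint mean (J : eqType) (s : seq J) (F : (J -> R) -> R) (w : J -> R) : R :=
  if s is e :: s' then \sum_(y <- vs) p y * mean s' F (upd w e y) else F w.

Section OneIndexType.
Variable J : eqType.
Implicit Types (s : seq J) (F : (J -> R) -> R) (w : J -> R).

Lemma mean_cst s (c : R) w : mean s (fun=> c) w = c.
Proof.
elim: s w => //= e s IHs w; under eq_bigr do rewrite IHs.
by rewrite -mulr_suml p_sum mul1r.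
Qed.

Lemma mean_ge0 s F w : (forall w', 0 <= F w') -> 0 <= mean s F w.
Proof.
move=> F0; elim: s w => //= e s IHs w.
by apply: sumr_ge0 => y _; exact: mulr_ge0.
Qed.

Lemma mean_sum (I : Type) (r : seq I) (P : pred I) s (F : I -> (J -> R) -> R) w :
  mean s (fun w' => \sum_(i <- r | P i) F i w') w = \sum_(i <- r | P i) mean s (F i) w.
Proof.
elim: s w => //= e s IHs w; rewrite exchange_big/=.
by apply: eq_bigr => y _; rewrite IHs mulr_sumr.
Qed.

(** The predicate [Q] restricts the comparison to configurations with admissible values, for
    instance to weights at most [K]. *)
Lemma le_mean (Q : R -> Prop) s F F' w : {in vs, forall y, Q y} ->
  (forall j, Q (w j)) -> (forall w', (forall j, Q (w' j)) -> F w' <= F' w') ->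
  mean s F w <= mean s F' w.
Proof.
move=> vsQ wQ FF'; elim: s w wQ => [|e s IHs] w wQ /=; first exact: FF'.
rewrite big_seq [leRHS]big_seq; apply: ler_sum => y yvs.
apply: ler_wpM2l => //; apply: IHs => j; rewrite /upd; case: eqP => // _.
exact: vsQ.
Qed.

(** Fubini for finite sums: updates at distinct coordinates commute. *)
Lemma mean_rem s F w e : uniq s -> e \in s -> mean s F w = mean (e :: rem e s) F w.
Proof.
elim: s w => //= e' s IHs w /andP[e's us]; rewrite inE eq_sym.
case: (eqVneq e' e) => [->//|e'e] /= es.
under eq_bigr do rewrite IHs//= mulr_sumr.
rewrite exchange_big/=; apply: eq_bigr => y _; rewrite mulr_sumr.
by apply: eq_bigr => z _; rewrite mulrCA (updC _ _ _ e'e).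
Qed.

Lemma mean_perm s t F w : uniq s -> perm_eq s t -> mean s F w = mean t F w.
Proof.
elim: t s w => [|e t IHt] s w us st; first by rewrite (perm_nilP st).
have es : e \in s by rewrite (perm_mem st) mem_head.
rewrite (mean_rem _ _ us es) /=; apply: eq_bigr => y _; congr (_ * _).
apply: IHt; first exact: rem_uniq.
by rewrite -(perm_cons e) -(permPl (perm_to_rem es)).
Qed.

(** A coordinate that [F] ignores is averaged out because the masses add up to 1. *)
Lemma mean_cat_irrelevant s t F w :
  {in s, forall e w y, F (upd w e y) = F w} -> mean (s ++ t) F w = mean t F w.
Proof.
have mean_upd e r w' y : (forall w'' z, F (upd w'' e z) = F w'') ->
    mean r F (upd w' e y) = mean r F w'.
  move=> Fe; elim: r w' => [|e' r IHr] w' /=; first exact: Fe.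
  apply: eq_bigr => z _; congr (_ * _).
  by case: (eqVneq e e') => [->|ee']; [rewrite upd_id|rewrite updC].
elim: s w => // e s IHs w Fs /=.
rewrite -[RHS]mul1r -p_sum mulr_suml; apply: eq_bigr => y _; congr (_ * _).
rewrite IHs => [|e' e's]; last by apply: Fs; rewrite inE e's orbT.
by apply: mean_upd; apply: Fs; rewrite mem_head.
Qed.

Variable K : R.

(** Averaging over other coordinates does not increase the oscillation in [e]; averaging over [e]
    itself removes it. *)
Lemma mean_lip s F : (forall w e, {in vs &, forall y z, F (upd w e y) - F (upd w e z) <= K}) ->
  0 <= K ->
  forall w e, {in vs &, forall y z, mean s F (upd w e y) - mean s F (upd w e z) <= K}.
Proof.
move=> FK K0; elim: s => [|e' s IHs] w e y z yvs zvs /=; first exact: FK.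
rewrite -sumrB; have [<-|ee'] := eqVneq e e'.
  by rewrite big1// => x _; rewrite !upd_id subrr.
rewrite -[leRHS]mul1r -p_sum mulr_suml big_seq [leRHS]big_seq; apply: ler_sum => x xvs.
by rewrite -mulrBr ler_wpM2l// !(updC _ _ _ ee') IHs.
Qed.

Let vs_sqr_dev (g : R -> R) c : 0 <= K ->
  {in vs &, forall y z, g y - g z <= K} ->
  \sum_(y <- vs) p y * (g y - c) ^+ 2 <= (\sum_(y <- vs) p y * g y - c) ^+ 2 + K ^+ 2.
Proof.
move=> K0 gK; set m := \sum_(y <- vs) p y * g y.
(* Squared bias plus variance; the cross term vanishes since [m] is the mean of [g]. The variance is
   at most [K ^+ 2] because [g] has oscillation at most [K] on [vs]. *)
have -> : \sum_(y <- vs) p y * (g y - c) ^+ 2 =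
    (m - c) ^+ 2 + \sum_(y <- vs) p y * (g y - m) ^+ 2.
  transitivity (\sum_(y <- vs) (p y * (g y - m) ^+ 2 + (2 * (m - c) * (p y * g y) +
      p y * ((m - c) ^+ 2 - 2 * (m - c) * m)))).
    by apply: eq_bigr => y _; ring.
  by rewrite !big_split/= -mulr_sumr -mulr_suml p_sum -/m; ring.
rewrite lerD2l -[leRHS]mul1r -p_sum mulr_suml big_seq [leRHS]big_seq.
apply: ler_sum => y yvs; rewrite ler_wpM2l// -ler_sqrt ?sqr_ge0//.
have gm x : x - m = \sum_(z <- vs) p z * (x - g z).
  under eq_bigr do rewrite mulrBr.
  by rewrite sumrB -mulr_suml p_sum mul1r.
rewrite !sqrtr_sqr (ger0_norm K0) ler_norml; apply/andP; split.
  rewrite lerNl opprB -[leRHS]mul1r -p_sum mulr_suml /m -[g y]mul1r -p_sum mulr_suml -sumrB.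
  rewrite big_seq [leRHS]big_seq; apply: ler_sum => z zvs.
  by rewrite -mulrBr ler_wpM2l// gK.
rewrite gm -[leRHS]mul1r -p_sum mulr_suml big_seq [leRHS]big_seq.
by apply: ler_sum => z zvs; rewrite ler_wpM2l// gK.
Qed.

(* Averaging over one coordinate moves [F] by at most [K], so each coordinate
   contributes at most [K ^+ 2] to the variance. *)
Lemma mean_sqr_dev s F c w : 0 <= K ->
  (forall w e, {in vs &, forall y z, F (upd w e y) - F (upd w e z) <= K}) ->
  mean s (fun w' => (F w' - c) ^+ 2) w <= (mean s F w - c) ^+ 2 + (size s)%:R * K ^+ 2.
Proof.
move=> K0 FK; elim: s w => [|e s IHs] w /=; first by rewrite mul0r addr0.
apply: (@le_trans _ _ (\sum_(y <- vs) (p y * (mean s F (upd w e y) - c) ^+ 2 +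
    p y * ((size s)%:R * K ^+ 2)))).
  by apply: ler_sum => y _; rewrite -mulrDr ler_wpM2l.
rewrite big_split/= -mulr_suml p_sum mul1r -(natr1 (size s)).
have := @vs_sqr_dev (fun y => mean s F (upd w e y)) c K0 (@mean_lip s F FK K0 w e).
by lra.
Qed.

End OneIndexType.

Lemma mean_map (J J' : eqType) (h : J -> J') (s : seq J) (F : (J -> R) -> R) (w : J' -> R) :
  injective h -> mean s F (w \o h) = mean (map h s) (fun w' => F (w' \o h)) w.
Proof.
move=> hi; elim: s w => //= e s IHs w; apply: eq_bigr => y _; congr (_ * _).
rewrite -IHs; congr mean; apply/funext => j /=.
by rewrite /upd (inj_eq hi).
Qed.

End IteratedMean.

(** * The mean gain of a fringe subtree *)

Section FringeGain.
Variables (R : realType) (vs : seq R) (p : R -> R).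
Hypothesis p_ge0 : forall y, 0 <= p y.
Hypothesis p_sum : \sum_(y <- vs) p y = 1.

Definition mean_weight (G : Defs.rgraph) (F : ({set 'I_(gsize G)} -> R) -> R) : R :=
  mean vs p (enum (gedges G)) F (fun=> 0).

Lemma descendants_root (G : rtree) : descendants (groot G) = [set: 'I_(gsize G)]%SET.
Proof.
apply/finset.setP => u; rewrite in_descendants finset.in_setT.
have /and3P[_ /eqP lp _] := root_path_simple u.
by rewrite -[X in X \in _]lp root_path_head mem_last.
Qed.

(** The gain at [v] reads only the edges below [v], which are the images of the edges of [H]; all
    other edges are averaged out. This makes the mean gain a function of the fringe subtree. *)
Lemma mean_weight_embed (H G : rtree) (h : 'I_(gsize H) -> 'I_(gsize G)) (v : 'I_(gsize G)) :
  injective h -> (forall a b, gadj (h a) (h b) = gadj a b) ->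
  h (groot H) = v -> h @: [set: 'I_(gsize H)]%SET = descendants v ->
  mean_weight (root_gain (R := R) v) = mean_weight (root_gain (R := R) (groot H)).
Proof.
move=> hi ha h0 him.
have hh : injective (fun e : {set 'I_(gsize H)} => h @: e) by exact: imset_inj.
have gainE w : root_gain v w = root_gain (groot H) (w \o (fun e : {set 'I_(gsize H)} => h @: e)).
  rewrite /root_gain -him descendants_root -h0.
  have -> : (h @: [set: 'I_(gsize H)] :\ h (groot H) = h @: ([set: 'I_(gsize H)] :\ groot H))%SET.
    apply/finset.setP => u; rewrite finset.in_setD1; apply/andP/imsetP.
      by move=> [uh /imsetP[a _ ua]]; exists a => //; rewrite !inE andbT -(inj_eq hi) -ua.
    by move=> [a + ->]; rewrite !inE andbT (inj_eq hi) => aH; split; rewrite ?mem_imset ?inE.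
  by congr (_ - _); rewrite max_matching_imset//; exact: tree_edge_card.
have -> : mean_weight (root_gain (R := R) (groot H)) =
    mean vs p (map (fun e : {set 'I_(gsize H)} => h @: e) (enum (gedges H)))
      (root_gain (R := R) v) (fun=> 0).
  rewrite /mean_weight -[X in mean _ _ _ _ X = _]/((fun=> 0) \o
    (fun e : {set 'I_(gsize H)} => h @: e)).
  by rewrite (mean_map _ _ _ _ _ hh); congr mean; apply/funext => w; rewrite gainE.
rewrite /mean_weight; set t := map _ _.
have tE : {subset t <= gedges G}.
  move=> _ /mapP[e + ->]; rewrite mem_enum; apply: edge_imset => //; exact: tree_edge_card.
have ut : uniq t by rewrite map_inj_uniq ?enum_uniq.
(* Reorder the edges so that the irrelevant ones come first. *)
rewrite [LHS](mean_perm _ _ _ _ (t := [seq e <- enum (gedges G) | e \notin t] ++ t)).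
- apply: mean_cat_irrelevant => // e; rewrite mem_filter mem_enum => /andP[et eE] w y.
  have updE f : f \in gedges G -> f \subset descendants v -> upd w e y f = w f.
    move=> fE; rewrite -him => fU; rewrite /upd; case: eqP => // fe; case/negP: et.
    have [g [gH _ gE]] := edge_imset_inv ha (@tree_edge_card G) fE fU.
    by apply/mapP; exists g; rewrite ?mem_enum// -fe.
  rewrite /root_gain; congr (_ - _); apply: eq_max_matching => f fE fU; apply: updE => //.
  apply: (fintype.subset_trans fU); exact: finset.subD1set.
- exact: enum_uniq.
-  apply: uniq_perm; first exact: enum_uniq.
    rewrite cat_uniq ut andbT (filter_uniq _ (enum_uniq _)).
    by apply/hasPn => e et; rewrite mem_filter et.
  move=> e; rewrite mem_cat mem_filter mem_enum; case: (boolP (e \in t)) => [/tE -> //|].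
  by rewrite orbF.
Qed.

Definition fringe_gain (t : utree) : R :=
  mean_weight (root_gain (R := R) (groot (utree_repr t))).

Lemma root_path_gt0 (G : rtree) (v : 'I_(gsize G)) : (0 < size (root_path v))%N.
Proof. by []. Qed.

Lemma spine0 (G : rtree) (v : 'I_(gsize G)) :
  spine v 0 = Some (utree_class (stem_tree (Ordinal (root_path_gt0 v)))).
Proof. by rewrite /spine (insubT (fun i => i < size (root_path v))%N (root_path_gt0 v)). Qed.

(** A root path has no repetition, so it has at most [gsize G] entries. *)
Lemma spine_None (G : rtree) (v : 'I_(gsize G)) k : (gsize G <= k)%N -> spine v k = None.
Proof.
move=> Gk; rewrite /spine insubN// -leqNgt; apply: leq_trans Gk.
have := card_uniqP (root_path_uniq v) => <-.
by rewrite -[leqRHS]card_ord max_card.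
Qed.

Lemma stem_set0 (G : rtree) (v : 'I_(gsize G)) : stem_set v 0 = descendants v.
Proof. by apply/finset.setP => u; rewrite !finset.in_set andbT. Qed.

Lemma utree_classK (G : rtree) : rtree_iso (utree_repr (utree_class G)) G.
Proof. by apply/eqquotP; rewrite /utree_repr /utree_class; exact: reprK. Qed.

(** The representative of the class is isomorphic to the stem tree; followed by [enum_val], this
    isomorphism embeds it onto the descendants of [v]. *)
Lemma fringe_gain_stem (G : rtree) (v : 'I_(gsize G)) :
  fringe_gain (utree_class (stem_tree (Ordinal (root_path_gt0 v)))) =
  mean_weight (root_gain (R := R) v).
Proof.
set k := Ordinal _; have /asboolP[h hb [h0 hE]] := utree_classK (stem_tree k).
rewrite /fringe_gain.
have [g hg gh] := hb.
apply/esym; apply: (@mean_weight_embed _ _ (fun a => enum_val (h a))).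
- by move=> a b /enum_val_inj /(bij_inj hb).
- by move=> a b; rewrite -hE; apply/esym; exact: induced_adj.
- by rewrite h0 enum_rankK_in//; exact: mem_stem_set.
- apply/finset.setP => u; rewrite -stem_set0; apply/imsetP/idP => [[a _ ->]|uS].
    exact: enum_valP.
  by exists (g (enum_rank_in uS u)); rewrite ?finset.in_setT// gh enum_rankK_in.
Qed.

Definition fringe_gain_opt (o : option utree) : R := oapp fringe_gain 0 o.

(** Linearity of the mean applied to [sum_root_gain]. After division by the number of vertices, the
    right-hand side is an integral against [Phi]. *)
Lemma mean_max_matching (G : rtree) :
  mean_weight (max_matching (R := R) [set: 'I_(gsize G)]%SET) =
  \sum_(v < gsize G) fringe_gain_opt (spine v 0).
Proof.
under [RHS]eq_bigr do rewrite spine0 /= fringe_gain_stem.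
rewrite /mean_weight -mean_sum; congr mean; apply/funext => w.
exact: sum_root_gain.
Qed.

Variable K : R.
Hypothesis K_ge0 : 0 <= K.
Hypothesis vsK : {in vs, forall y, `|y| <= K}.

(** Deleting the root cannot increase the maximal weight, and loses at most the single matched edge
    at the root. *)
Lemma fringe_gain_bounds t : 0 <= fringe_gain t <= K.
Proof.
rewrite /fringe_gain /mean_weight; set s := enum _; apply/andP; split.
  rewrite -[leLHS](mean_cst p_sum s 0 (fun=> 0)).
  apply: (@le_mean _ _ _ p_ge0 _ (fun _ : R => True%type)) => // w _.
  by rewrite /root_gain subr_ge0 max_matching_mono// finset.subD1set.
rewrite -[leRHS](mean_cst p_sum s K (fun=> 0)).
apply: (@le_mean _ _ _ p_ge0 _ (fun y : R => (y <= K) : Prop)) => // [y /vsK|w wK].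
  exact/le_trans/ler_norm.
by rewrite /root_gain lerBlDl max_matching_setD1.
Qed.

(** Changing one weight among values bounded by [K] moves the maximal weight by at most [2 * K], and
    there are at most [gsize G] edges. *)
Lemma mean_weight_sqr_dev (G : rtree) (F := max_matching (R := R) [set: 'I_(gsize G)]%SET) :
  mean_weight (fun w => (F w - mean_weight F) ^+ 2) <= (gsize G)%:R * (2 * K) ^+ 2.
Proof.
apply: (le_trans (@mean_sqr_dev _ vs p p_ge0 p_sum _ (2 * K) (enum (gedges G)) F
  (mean_weight F) (fun=> 0) _ _)).
- exact: (mulr_ge0 _ K_ge0).
- move=> w e y z yvs zvs; apply: le_trans (ler_norm _) _.
  apply: (le_trans (max_matching_lip _ _ _)).
  apply: (@le_trans _ _ (\sum_(f : {set 'I_(gsize G)} | f == e) 2 * K)); last first.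
    by rewrite big_pred1_eq.
  rewrite (bigID (fun f => f == e))/= [X in _ + X]big1 ?addr0; last first.
    by move=> f /andP[_ fe]; rewrite /upd (negbTE fe) subrr normr0.
  rewrite [leLHS]big_mkcond [leRHS]big_mkcond; apply: ler_sum => f _.
  rewrite /upd; case: (f == e); rewrite ?andbF//= andbT.
  case: ifP => _; last exact: mulr_ge0.
  by rewrite mulr_natl mulr2n (le_trans (ler_normB _ _))// lerD ?vsK.
rewrite -/(mean_weight F) subrr expr0n/= add0r ler_wpM2r ?sqr_ge0// ler_nat -cardE.
exact: card_tree_edges.
Qed.

End FringeGain.

(** * Weights given the tree *)

Section ConditionalLaw.
Variables (R : realType) (d : measure_display) (Omega : measurableType d).
Variables (P : probability Omega R) (D : set Omega).
Hypothesis mD : measurable D.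
Local Open Scope classical_set_scope.
Local Open Scope ereal_scope.

(** The image under [X] of [P] restricted to [D] is [P D] times [nu]. The patch [X \_ D] is
    measurable everywhere, and the restricted measure does not see the patched values. *)
Lemma ge0_integral_cond_law d' (Y : measurableType d') (nu : probability Y R)
    (X : Omega -> Y) (g : Y -> \bar R) :
  measurable_fun D X -> (forall B, measurable B -> P (D `&` X @^-1` B) = P D * nu B) ->
  measurable_fun setT g -> (forall x, 0 <= g x) ->
  \int[P]_(w in D) g (X w) = P D * \int[nu]_x g x.
Proof.
move=> mX lawX mg g0.
have mX' : measurable_fun [set: Omega] (X \_ D).
  by apply/(measurable_restrictT _ mD).
pose mu := mrestr P mD.
have mgX : measurable_fun [set: Omega] (fun w => g ((X \_ D) w)).
  exact: measurableT_comp.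
have -> : \int[P]_(w in D) g (X w) = \int[mu]_w g ((X \_ D) w).
  rewrite -(setUv D) ge0_integral_setU//=; last 3 first.
  - exact: measurableC.
  - by rewrite setUv.
  - by apply/disj_setPCl.
  rewrite [X in _ = _ + X]null_set_integral ?adde0; last 3 first.
  - exact: measurableC.
  - exact: measurable_funS mgX.
  - by rewrite /= /mrestr classical_sets.setICl measure0.
  rewrite [RHS](eq_measure_integral P) => [|A mA AD].
    apply: eq_integral => w wD /=; rewrite /patch wD//.
  by rewrite /mu /mrestr; congr (P _); apply/setIidPl.
rewrite -[LHS]/(\int[mu]_(w in (X \_ D) @^-1` [set: Y]) _).
rewrite -(ge0_integral_pushforward mX')//.
have PD : (0 <= fine (P D))%R by rewrite fine_ge0.
rewrite (eq_measure_integral (mscale (NngNum PD) nu)) => [|A mA _].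
  rewrite ge0_integral_mscale//= fineK//; exact: fin_num_measure.
rewrite /= /pushforward /mu /= /mrestr /mscale /= fineK; last exact: fin_num_measure.
rewrite -lawX// setIC; congr (P _).
by apply/seteqP; split => w [Dw]; rewrite /= /patch mem_set.
Qed.

End ConditionalLaw.

(** * Weights rounded to finitely many values *)

Section SimpleWeights.
Variables (R : realType) (nu : probability (measurableTypeR R) R).
Variables (phi : R -> R) (vs : seq R).
Hypothesis mphi : measurable_fun [set: R] phi.
Hypothesis vs_uniq : uniq vs.
Hypothesis phi_vs : forall x, phi x \in vs.
Local Open Scope classical_set_scope.

Definition point_mass (y : R) : R := fine (nu (phi @^-1` [set y])).

Lemma measurable_level y : measurable (phi @^-1` [set y]).
Proof. by rewrite -[X in measurable X]setTI; apply: mphi. Qed.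

Lemma point_mass_ge0 y : 0 <= point_mass y.
Proof. by rewrite fine_ge0. Qed.

Lemma point_massE y : (point_mass y)%:E = nu (phi @^-1` [set y]).
Proof. by rewrite fineK//; apply: fin_num_measure; exact: measurable_level. Qed.

Lemma sum_point_mass : \sum_(y <- vs) point_mass y = 1.
Proof.
apply: EFin_inj; rewrite -sumEFin; under eq_bigr do rewrite point_massE.
have <- : nu [set: _] = 1%E by exact: probability_setT.
have -> : [set: R] = \bigcup_(y in [set` vs]) phi @^-1` [set y].
  by apply/esym; apply/seteqP; split => // x _; exists (phi x) => //=; exact: phi_vs.
rewrite measure_fin_bigcup//.
- by rewrite fsbig_seq.
- exact: finite_seq.
- exact: trivIset_preimage1.
- by move=> y _; exact: measurable_level.
Qed.

Variables (d : measure_display) (Omega : measurableType d).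
Variables (P : probability Omega R) (D : set Omega).
Hypothesis mD : measurable D.
Variables (J : finType) (E : {set J}) (X : J -> Omega -> R).
Hypothesis mX : forall e, e \in E -> measurable_fun D (X e).
Hypothesis indepX : forall A : J -> set R, (forall e, measurable (A e)) ->
  (P (D `&` [set w | forall e, e \in E -> A e (X e w)]) =
   P D * \prod_(e in E) nu (A e))%E.

Definition rounded (w : Omega) (e : J) : R := if e \in E then phi (X e w) else 0.

(** The event in [D] where the rounded weights of the edges outside [s] are prescribed by [a], while
    those in [s] are free. *)
Let cell (s : seq J) (a : J -> R) : set Omega :=
  D `&` [set w | forall e, e \in E -> (if e \in s then setT else phi @^-1` [set a e]) (X e w)].

Let measurable_cell s a : measurable (cell s a).
Proof.
rewrite (_ : cell s a = D `&` \bigcap_(e in [set` E])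
    (D `&` X e @^-1` (if e \in s then setT else phi @^-1` [set a e]))).
  apply: measurableI => //; apply: fin_bigcap_measurable => // e eE.
  apply: mX => //; case: ifP => // _; exact: measurable_level.
apply/seteqP; split => w [Dw h]; split => // e eE; first by split => //; exact: h.
by case: (h e eE).
Qed.

(** Cutting a cell according to the rounded value of one free edge produces one of the sums in
    [mean]. With no free edge left the integrand is constant, and the product formula gives the
    probability of the cell. *)
Lemma integral_rounded (F : (J -> R) -> R) : (forall a, 0 <= F a) ->
  measurable_fun D (fun w => F (rounded w)) ->
  (\int[P]_(w in D) (F (rounded w))%:E =
   P D * (mean vs point_mass (enum E) F (fun=> 0))%:E)%E.
Proof.
move=> F0 mF.
have mEF : measurable_fun D (fun w => (F (rounded w))%:E) by exact/measurable_EFinP.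
(* For [s = enum E] the cell is [D] and the product over prescribed edges is empty. *)
suff cellE s a : uniq s -> {subset s <= E} -> (forall e, e \notin E -> a e = 0) ->
    (\int[P]_(w in cell s a) (F (rounded w))%:E = P D *
      (\prod_(e in E | e \notin s) point_mass (a e) * mean vs point_mass s F a)%:E)%E.
  have -> : D = cell (enum E) (fun=> 0).
    apply/seteqP; split => w; last by case.
    by move=> Dw; split => // e eE; rewrite mem_enum eE.
  rewrite cellE ?enum_uniq// => [|e]; last by rewrite mem_enum.
  rewrite big_pred0 ?mul1r => [|e]; last by rewrite mem_enum andbN.
  congr (P _ * _)%E; apply/seteqP; split => w; last by case.
  by move=> Dw; split => // e eE; rewrite mem_enum eE.
elim: s a => [|e s IHs] a /=.
  move=> _ _ a0.
  have -> : (\int[P]_(w in cell [::] a) (F (rounded w))%:E =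
      \int[P]_(w in cell [::] a) (cst (F a)%:E) w)%E.
    apply: eq_integral => w /set_mem[Dw cw]; congr (F _)%:E; apply/funext => e.
    by rewrite /rounded; case: ifPn => [eE|/a0 //]; exact: cw.
  rewrite integral_cst//.
  transitivity ((F a)%:E * (P D * \prod_(e in E) nu (phi @^-1` [set a e])))%E.
    congr (_ * _)%E.
    by apply: (@indepX (fun e => phi @^-1` [set a e])) => e; exact: measurable_level.
  rewrite (eq_bigr (fun e => (point_mass (a e))%:E)) => [|e _]; last by rewrite point_massE.
  rewrite prodEFin muleCA; congr (_ * _)%E; rewrite -EFinM mulrC; congr (_ * _)%:E.
  by apply: eq_bigl => e; rewrite andbT.
move=> /andP[es us] esE a0.
have eE : e \in E by apply: esE; rewrite mem_head.
have sE : {subset s <= E} by move=> f fs; apply: esE; rewrite inE fs orbT.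
have -> : cell (e :: s) a = \big[setU/set0]_(y <- vs) cell s (upd a e y).
  rewrite -bigcup_seq; apply/seteqP; split => [w [Dw cw]|w [y _ [Dw cw]]].
    exists (phi (X e w)); first exact: phi_vs.
    split => // f fE; have := cw f fE; rewrite inE /upd.
    by have [->|] := eqVneq f e; first by rewrite (negbTE es).
  split => // f fE; have := cw f fE; rewrite inE /upd.
  by have [->|] := eqVneq f e.
rewrite ge0_integral_bigsetU//=; last first.
- by move=> w _; rewrite lee_fin.
- apply: measurable_funS mEF => //.
  by rewrite -bigcup_seq => w [y _ []].
- move=> y z _ _ [w [[_ cy] [_ cz]]].
  have := cy e eE; have := cz e eE; rewrite (negbTE es) /upd eqxx /= => -> //.
under eq_bigr => y _.
  rewrite IHs//; last first.
    by move=> f fE; rewrite /upd; case: eqP => [fe|_]; [rewrite fe eE in fE|exact: a0].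
  over.
rewrite /= -ge0_sume_distrr; last first.
  move=> y _; rewrite lee_fin mulr_ge0 ?mean_ge0//; last exact: point_mass_ge0.
  by apply: prodr_ge0 => f _; exact: point_mass_ge0.
congr (_ * _)%E; rewrite sumEFin; congr EFin; rewrite mulr_sumr; apply: eq_bigr => y _.
rewrite mulrA; congr (_ * _).
rewrite (bigD1 e)/= ?eE// /upd eqxx mulrC; congr (_ * _).
apply: eq_big => [f|f /andP[_ /negbTE ->]//].
by rewrite inE negb_or -andbA [in LHS](andbC (f \notin s)).
Qed.

End SimpleWeights.

(** * The truncated error given the tree *)

Section CondBound.
Variables (R : realType) (nu : probability (measurableTypeR R) R).
Variables (phi : R -> R) (vs : seq R).
Hypothesis mphi : measurable_fun [set: R] phi.
Hypothesis vs_uniq : uniq vs.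
Hypothesis phi_vs : forall x, phi x \in vs.
Variables (K delta : R).
Hypothesis K_ge0 : 0 <= K.
Hypothesis vsK : {in vs, forall y, `|y| <= K}.
Hypothesis phi_delta : (\int[nu]_x (`|x - phi x|)%:E <= delta%:E)%E.
Local Open Scope classical_set_scope.

Variables (d : measure_display) (Omega : measurableType d).
Variables (P : probability Omega R) (D : set Omega).
Hypothesis mD : measurable D.

Lemma measurable_max_matching (G : Defs.rgraph) (U : {set 'I_(gsize G)})
    (X : {set 'I_(gsize G)} -> Omega -> R) :
  (forall e, measurable_fun D (X e)) ->
  measurable_fun D (fun w => max_matching U (X ^~ w)).
Proof.
move=> mX; rewrite /max_matching.
elim: (index_enum _) => [|S r IHr].
  by under eq_fun do rewrite big_nil; exact: measurable_cst.
under eq_fun do rewrite big_cons.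
case: (matching_in U S) => //.
apply: measurable_maxr => //.
rewrite (_ : (fun w => _) = (fun w => \sum_(e <- enum S) X e w)).
  exact: measurable_sum.
by apply/funext => w; rewrite big_enum.
Qed.

Variables (G : rtree) (X : {set 'I_(gsize G)} -> Omega -> R).
Local Notation E := (gedges G).
Local Notation N := ((gsize G)%:R : R).
Local Notation M := (max_matching (R := R) [set: 'I_(gsize G)]%SET).
Hypothesis mX : forall e, measurable_fun D (X e).
Hypothesis indepX : forall A : {set 'I_(gsize G)} -> set R, (forall e, measurable (A e)) ->
  (P (D `&` [set w | forall e, e \in E -> A e (X e w)]) =
   P D * \prod_(e in E) nu (A e))%E.

Lemma gsize_gt0 (H : Defs.rgraph) : (0 < gsize H)%N.
Proof. exact: leq_ltn_trans (leq0n _) (ltn_ord (groot H)). Qed.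

Let N_gt0 : 0 < N.
Proof. by rewrite ltr0n gsize_gt0. Qed.

(** The product formula for the family that is [B] at [e] and everything elsewhere. *)
Let cond_law e B : e \in E -> measurable B -> (P (D `&` X e @^-1` B) = P D * nu B)%E.
Proof.
move=> eE mB; have := @indepX (fun f => if f == e then B else setT).
rewrite (bigD1 e)//= eqxx big1 ?mule1 => [<-|f /andP[_ /negbTE ->]]; last 2 first.
- by move=> f; case: ifP.
- exact: probability_setT.
congr (P _); apply/seteqP; split => w [Dw h]; split => //.
  by move=> f fE; case: eqP => // ->.
by have := h e eE; rewrite eqxx.
Qed.

Let meanM := mean_weight vs (point_mass nu phi) M.

Let mrounded e : measurable_fun D (fun w => rounded phi E X w e).
Proof.
rewrite /rounded; case: (e \in E); last exact: measurable_cst.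
by apply: measurableT_comp => //; exact: mX.
Qed.

Let mMX : measurable_fun D (fun w => M (X ^~ w)).
Proof. exact: measurable_max_matching. Qed.

Let mMY : measurable_fun D (fun w => M (rounded phi E X w)).
Proof. exact: (@measurable_max_matching _ _ (fun e w => rounded phi E X w e)). Qed.

Let l1_err w := \sum_(e <- enum E) N^-1 * `|X e w - phi (X e w)|.
Let l2_err (eta : R) w := eta^-1 * (N^-1 ^+ 2) * (M (rounded phi E X w) - meanM) ^+ 2.

(** Triangle inequality through the rounded weights and their mean. The fluctuation [x] is handled
    by [|x| <= eta + x ^+ 2 / eta], so that a variance bound suffices. *)
Let pointwise_bound (eta c : R) w : 0 < eta ->
  Num.min 1 `|N^-1 * M (X ^~ w) - c| <=
  (l1_err w + l2_err eta w) + (eta + Num.min 1 `|N^-1 * meanM - c|).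
Proof.
move=> eta0.
have h1 : `|N^-1 * M (X ^~ w) - N^-1 * M (rounded phi E X w)| <= l1_err w.
  rewrite -mulrBr normrM ger0_norm ?invr_ge0 ?(ltW N_gt0)//.
  rewrite /l1_err -mulr_sumr ler_wpM2l ?invr_ge0 ?(ltW N_gt0)//.
  apply: (le_trans (max_matching_lip _ _ _)); rewrite big_enum/=.
  rewrite big_mkcond [leRHS]big_mkcond/=; apply: ler_sum => e _.
  rewrite /rounded; case: (e \in E) => //=; case: ifP => // _.
have h2 : `|N^-1 * M (rounded phi E X w) - N^-1 * meanM| <= eta + l2_err eta w.
  rewrite -mulrBr /l2_err -mulrA -exprMn; set x := _ * _.
  rewrite -(@ler_pM2l _ eta)// mulrDr mulrA mulfV ?gt_eqF// mul1r -(real_normK (num_real x)).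
  rewrite -subr_ge0; have := sqr_ge0 (eta - `|x|); have := mulr_ge0 (ltW eta0) (normr_ge0 x).
  by rewrite !expr2; lra.
have h3 : Num.min 1 `|N^-1 * M (X ^~ w) - c| <=
    `|N^-1 * M (X ^~ w) - N^-1 * meanM| + Num.min 1 `|N^-1 * meanM - c|.
  have := ler_distD (N^-1 * meanM) (N^-1 * M (X ^~ w)) c.
  have := normr_ge0 (N^-1 * M (X ^~ w) - N^-1 * meanM).
  by rewrite !minEle; case: ifP; case: ifP; lra.
have := ler_distD (N^-1 * M (rounded phi E X w)) (N^-1 * M (X ^~ w)) (N^-1 * meanM).
by lra.
Qed.

Let ml1 : measurable_fun D l1_err.
Proof.
apply: measurable_sum => e; apply: measurable_funM; first exact: measurable_cst.
apply: measurableT_comp => //; apply: measurable_funB => //.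
by apply: measurableT_comp => //; exact: mX.
Qed.

Let ml2 eta : measurable_fun D (l2_err eta).
Proof.
apply: measurable_funM; first exact: measurable_cst.
by apply: measurable_funX; apply: measurable_funB => //; exact: measurable_cst.
Qed.

Let l1_err_ge0 w : 0 <= l1_err w.
Proof. by apply: sumr_ge0 => e _; rewrite mulr_ge0// invr_ge0 ltW. Qed.

Let l2_err_ge0 (eta : R) w : 0 < eta -> 0 <= l2_err eta w.
Proof. by move=> eta0; rewrite /l2_err mulr_ge0 ?sqr_ge0// mulr_ge0 ?sqr_ge0// invr_ge0 ltW. Qed.

(** Each edge costs at most [P D * delta / N], and there are at most [N] edges. *)
Let integral_l1_err : (\int[P]_(w in D) (l1_err w)%:E <= P D * delta%:E)%E.
Proof.
have mg : measurable_fun setT (fun x : measurableTypeR R => (`|x - phi x|)%:E).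
  apply/measurable_EFinP; apply: measurableT_comp => //.
  by apply: measurable_funB => //; exact: measurable_id.
under eq_integral do rewrite /l1_err -sumEFin.
rewrite ge0_integral_sum//; last first.
  move=> e; apply/measurable_EFinP; apply: measurable_funM; first exact: measurable_cst.
  apply: measurableT_comp => //; apply: measurable_funB => //.
  by apply: measurableT_comp => //; exact: mX.
rewrite big_enum/=.
have term e : e \in E -> (\int[P]_(w in D) (N^-1 * `|X e w - phi (X e w)|)%:E <=
    P D * delta%:E * N^-1%:E)%E.
  move=> eE; under eq_integral do rewrite EFinM.
  rewrite ge0_integralZl_EFin ?invr_ge0 ?(ltW N_gt0)//; last 1 first.
    apply/measurable_EFinP.
    apply: measurableT_comp => //; apply: measurable_funB => //.
    by apply: measurableT_comp => //; exact: mX.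
  rewrite (@ge0_integral_cond_law _ _ _ _ _ mD _ (measurableTypeR R) nu (X e)
     (fun x : measurableTypeR R => (`|x - phi x|)%:E))//.
  - rewrite muleC lee_wpmul2r ?lee_fin ?invr_ge0 ?(ltW N_gt0)//.
    by rewrite lee_wpmul2l.
  - exact: mX.
  - by move=> B mB; exact: cond_law.
apply: (@le_trans _ _ (\sum_(e in E) P D * delta%:E * N^-1%:E)%E); first exact: lee_sum.
have PDf : P D \is a fin_num by exact: fin_num_measure.
have delta0 : (0 <= delta)%R.
  by rewrite -lee_fin; apply: le_trans phi_delta; apply: integral_ge0.
rewrite -(fineK PDf) -!EFinM sumEFin lee_fin sumr_const -[leLHS]mulr_natr -mulrA.
rewrite ler_piMr ?mulr_ge0 ?fine_ge0//.
by rewrite mulrC ler_pdivrMr// mul1r ler_nat card_tree_edges.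
Qed.

Let integral_l2_err (eta : R) : 0 < eta ->
  (\int[P]_(w in D) (l2_err eta w)%:E <= P D * (eta^-1 * ((2 * K) ^+ 2 * N^-1))%:E)%E.
Proof.
move=> eta0.
under eq_integral do rewrite /l2_err EFinM.
rewrite ge0_integralZl_EFin//; last 3 first.
- by move=> w _; rewrite lee_fin sqr_ge0.
- by apply/measurable_EFinP; apply: measurable_funX; apply: measurable_funB.
- by rewrite mulr_ge0 ?sqr_ge0// invr_ge0 ltW.
rewrite (integral_rounded mphi vs_uniq phi_vs mD (fun e _ => mX e) indepX
  (F := fun a => (M a - meanM) ^+ 2)); last 2 first.
- by move=> a; exact: sqr_ge0.
- by apply: measurable_funX; apply: measurable_funB.
rewrite muleCA lee_wpmul2l// -EFinM lee_fin -mulrA ler_wpM2l ?invr_ge0 ?(ltW eta0)//.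
have := mean_weight_sqr_dev (point_mass_ge0 nu phi)
  (sum_point_mass nu mphi vs_uniq phi_vs) K_ge0 vsK G.
rewrite -/meanM => h.
apply: (le_trans (ler_wpM2l (sqr_ge0 _) h)).
suff -> : N^-1 ^+ 2 * (N * (2 * K) ^+ 2) = (2 * K) ^+ 2 * N^-1 by [].
by field; rewrite gt_eqF.
Qed.

Lemma cond_truncated_dist_le (eta c : R) : 0 < eta ->
  (\int[P]_(w in D) (Num.min 1 `|N^-1 * M (X ^~ w) - c|)%:E <=
   P D * (delta + eta^-1 * ((2 * K) ^+ 2 * N^-1) +
          (eta + Num.min 1 `|N^-1 * meanM - c|))%:E)%E.
Proof.
move=> eta0; set k := eta + _.
have k0 : 0 <= k by rewrite addr_ge0 ?(ltW eta0)// le_min ler01 normr_ge0.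
apply: (@le_trans _ _ (\int[P]_(w in D) ((l1_err w)%:E + (l2_err eta w)%:E + k%:E))%E).
  apply: ge0_le_integral => //.
  - apply/measurable_EFinP; apply: measurable_minr; first exact: measurable_cst.
    apply: measurableT_comp => //; apply: measurable_funB => //.
    by apply: measurable_funM => //; exact: measurable_cst.
  - apply: emeasurable_funD; last exact: measurable_cst.
    by apply: emeasurable_funD; apply/measurable_EFinP.
  - by move=> w _; rewrite -!EFinD lee_fin; exact: pointwise_bound.
rewrite ge0_integralD//; last 2 first.
- by move=> w _; rewrite -EFinD lee_fin addr_ge0// l2_err_ge0.
- by apply: emeasurable_funD; apply/measurable_EFinP.
rewrite ge0_integralD//; last 4 first.
- by move=> w _; rewrite lee_fin.
- by apply/measurable_EFinP.
- by move=> w _; rewrite lee_fin l2_err_ge0.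
- by apply/measurable_EFinP.
rewrite integral_cst// [X in (_ + X <= _)%E]muleC.
have PDf : P D \is a fin_num by exact: fin_num_measure.
rewrite (EFinD (_ + _)) muleDr// leeD//.
rewrite (EFinD delta) muleDr// leeD//; exact: integral_l2_err.
Qed.

End CondBound.

(** * Convergence in distribution to a constant *)

From mathcomp Require Import lra.
Local Open Scope classical_set_scope.

Lemma bounded_fun_exists (R : realType) (T : Type) (f : T -> R) :
  bounded_fun f <-> exists B : R, forall x, `|f x| <= B.
Proof.
split=> [fb|[B fB]].
  have [B fB] := @filter_ex _ (+oo : set_system R) _ _ fb.
  by exists B => x; exact: fB.
exists B; split => [|M BM x _]; first exact: num_real.
exact: le_trans (fB x) (ltW BM).
Qed.

Lemma integrable_bounded (R : realType) d (T : measurableType d) (P : probability T R)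
    (f : T -> R) (B : R) :
  measurable_fun setT f -> (forall x, `|f x| <= B) -> P.-integrable setT (EFin \o f).
Proof.
move=> mf fB; apply: measurable_bounded_integrable => //.
  by rewrite (le_lt_trans (probability_le1 P measurableT))// ltry.
by apply/bounded_fun_exists; exists B.
Qed.

Section TruncatedDist.
Variables (R : realType) (d : nat -> measure_display) (Omega : forall n, measurableType (d n)).
Variables (P : forall n, probability (Omega n) R) (W : forall n, Omega n -> R).
Hypothesis mW : forall n, measurable_fun setT (@W n).

(** Its convergence to 0 is convergence of [W] to [c] in probability; the truncation makes the
    integral finite for every measurable [W]. *)
Definition tdist (n : nat) (c : R) : R := \int[P n]_w Num.min 1 `|W w - c|.

Let integrable_tdist n c : (P n).-integrable setT (EFin \o (fun w => Num.min 1 `|W w - c|)).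
Proof.
apply: (@integrable_bounded _ _ _ _ _ 1).
  apply: measurable_minr; first exact: measurable_cst.
  by apply: measurableT_comp => //; apply: measurable_funB => //.
by move=> w; rewrite ger0_norm ?ge_min ?lexx// le_min ler01 normr_ge0.
Qed.

Let integrable_cst n (c : R) : (P n).-integrable setT (EFin \o (fun=> c)).
Proof. exact: (@integrable_bounded _ _ _ _ _ `|c|). Qed.

Let Rintegral_prob_cst n (c : R) : \int[P n]_w c = c.
Proof. by rewrite Rintegral_cst// [X in fine X](probability_setT (P n)) mulr1. Qed.

(** Constants close to the same random variable are close to each other; this yields the Cauchy
    property of the approximating constants. *)
Lemma tdist_centers n c c' : Num.min 1 `|c - c'| <= tdist n c + tdist n c'.
Proof.
rewrite -[leLHS](Rintegral_prob_cst n) /tdist -RintegralD//.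
apply: le_Rintegral => // [|w _].
  exact: (integrableD measurableT (integrable_tdist n c) (integrable_tdist n c')).
have := ler_distD (W w) c c'; rewrite (distrC c (W w)).
have := normr_ge0 (W w - c); have := normr_ge0 (W w - c').
by rewrite !minEle; case: ifP; case: ifP; case: ifP; lra.
Qed.

Lemma tdist_shift n c c' : tdist n c <= tdist n c' + `|c - c'|.
Proof.
rewrite -[X in _ + X](Rintegral_prob_cst n) /tdist -RintegralD//.
apply: le_Rintegral => // [|w _].
  exact: (integrableD measurableT (integrable_tdist n c') (integrable_cst n _)).
have := ler_distD c' (W w) c; rewrite (distrC c' c).
have := normr_ge0 (c - c').
by rewrite !minEle; case: ifP; case: ifP; lra.
Qed.

Lemma cvg_in_distribution_tdist c : tdist n c @[n --> \oo] --> 0 ->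
  cvg_in_distribution_cst P W c.
Proof.
move=> Wc f fcont /bounded_fun_exists[B fB]; apply/cvgrPdist_le => eps eps0.
have eps2 : 0 < eps / 2 by rewrite divr_gt0.
have [r /= r0 fr] : exists2 r : R, 0 < r & forall x, `|x - c| < r -> `|f x - f c| <= eps / 2.
  have /cvgrPdist_le/(_ _ eps2) := fcont c; rewrite near_simpl => /nbhs_ballP[r /= r0 h].
  exists r => // x xr; rewrite distrC; apply: h.
  by rewrite /ball/= distrC.
have B0 : 0 <= B by exact: le_trans (fB c).
(* With this [C] the product [C * Num.min 1 |x - c|] is at least [2 * B] once [|x - c|] reaches [r];
   closer to [c], continuity of [f] is enough. *)
pose C := 2 * B / Num.min 1 r.
have m0 : 0 < Num.min 1 r by rewrite lt_min ltr01.
have C0 : 0 <= C by rewrite /C !mulr_ge0 ?invr_ge0 ?(ltW m0).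
have fC x : `|f x - f c| <= eps / 2 + C * Num.min 1 `|x - c|.
  have [xr|rx] := ltP `|x - c| r.
    by rewrite (le_trans (fr _ xr))// lerDl mulr_ge0// le_min ler01 normr_ge0.
  apply: (@le_trans _ _ (2 * B)).
    by rewrite (le_trans (ler_normB _ _))// mulr_natl mulr2n lerD.
  rewrite -[leLHS]add0r lerD ?(ltW eps2)// /C -mulrA ler_peMr ?mulr_ge0//.
  by rewrite mulrC ler_pdivlMr// mul1r le_min !ge_min lexx rx orbT.
have mf : measurable_fun setT f by exact: continuous_measurable_fun.
have ifW n : (P n).-integrable setT (EFin \o (fun w => f (W w))).
  apply: (@integrable_bounded _ _ _ _ _ B) => //.
  by apply: measurableT_comp => //; exact: mW.
(* [C] may be 0, so the division below is by [C + 1]. *)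
have C1 : 0 < C + 1 by lra.
have Wc0 : \forall n \near \oo, `|tdist n c| <= eps / 2 / (C + 1).
  by apply: cvgr0_norm_le => //; exact: divr_gt0.
near=> n; have Wn : `|tdist n c| <= eps / 2 / (C + 1) by near: n.
rewrite -[X in `|X - _|](Rintegral_prob_cst n) distrC -RintegralB//.
apply: (le_trans (le_normr_Rintegral _ _)) => //.
  exact: (integrableB measurableT (ifW n) (integrable_cst n _)).
have iC : (P n).-integrable setT (EFin \o (fun w => C * Num.min 1 `|W w - c|)).
  exact: (integrableZl measurableT C (integrable_tdist n c)).
apply: (@le_trans _ _ (eps / 2 + C * tdist n c)).
  rewrite -[X in X + _](Rintegral_prob_cst n) /tdist -RintegralZl// -RintegralD//.
  apply: le_Rintegral => //.
  - apply: (@integrable_bounded _ _ _ _ _ (2 * B)).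
      by apply: measurableT_comp => //; apply: measurable_funB => //;
        apply: measurableT_comp => //; exact: mW.
    by move=> w; rewrite normr_id (le_trans (ler_normB _ _))// mulr_natl mulr2n lerD.
  - exact: (integrableD measurableT (integrable_cst n (eps / 2)) iC).
have t0 : 0 <= tdist n c.
  by apply: Rintegral_ge0 => w _; rewrite le_min ler01 normr_ge0.
move: Wn; rewrite ger0_norm// ler_pdivlMr// => Wn.
have : 0 <= tdist n c by [].
by lra.
Unshelve. all: by end_near. Qed.

Lemma cvg_in_distribution_lim (c_ : nat -> R) :
  (forall k eps, 0 < eps -> \forall n \near \oo, tdist n (c_ k) <= k.+1%:R^-1 + eps) ->
  cvg_in_distribution_cst P W (lim (c_ @ \oo)).
Proof.
move=> tc.
have c_dist k l : Num.min 1 `|c_ k - c_ l| <= k.+1%:R^-1 + l.+1%:R^-1.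
  apply/ler_addgt0Pr => eps eps0; have eps2 : 0 < eps / 2 by rewrite divr_gt0.
  have [n [nk nl]] := filter_ex (filterI (tc k _ eps2) (tc l _ eps2)).
  apply: (le_trans (tdist_centers n _ _)).
  by apply: (le_trans (lerD nk nl)); rewrite addrACA -splitr.
have c_cvg : cvg (c_ @ \oo).
  apply/cauchy_cvgP/cauchy_exP => eps /= eps0.
  have e0 : 0 < Num.min 1 eps / 2 by rewrite divr_gt0// lt_min ltr01.
  have [k _ kP] := near_infty_natSinv_lt (PosNum e0).
  exists (c_ k), k => // l /= kl; rewrite /ball/=.
  have kS : k.+1%:R^-1 < Num.min 1 eps / 2 := kP k (leqnn k).
  have lS : l.+1%:R^-1 < Num.min 1 eps / 2 := kP l kl.
  (* A truncated distance below [Num.min 1 eps] is below 1, so it is the true distance, and it is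
     below [eps]. *)
  have := le_lt_trans (c_dist k l) (ltrD kS lS); rewrite -splitr.
  by rewrite lt_min !gt_min ltxx/= => /andP[x1 /orP[/(lt_trans x1)|]].
apply: cvg_in_distribution_tdist; apply/cvgr0Pnorm_le => eps eps0.
have e4 : 0 < eps / 4 by rewrite divr_gt0.
have [k [kc ke]] := filter_ex (filterI (@cvgr_dist_le _ _ _ _ _ _ _ c_cvg _ e4)
  (near_infty_natSinv_lt (PosNum e4))).
near=> n; rewrite ger0_norm; last first.
  by apply: Rintegral_ge0 => w _; rewrite le_min ler01 normr_ge0.
have := tdist_shift n (lim (c_ @ \oo)) (c_ k).
have tk : tdist n (c_ k) <= k.+1%:R^-1 + eps / 4 by near: n; exact: tc.
have {}ke : k.+1%:R^-1 < eps / 4 := ke.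
move=> /le_trans; apply; apply: (le_trans (lerD tk kc)).
by move: ke; move: (k.+1%:R^-1) => a; lra.
Unshelve. all: by end_near. Qed.

End TruncatedDist.

(** * Functionals of the fringe measure *)

Section CoordinateFunctionals.
Variables (R : realType) (g : option utree -> R) (k : nat).

Lemma nbhs_coord (s : fringe_seq) (A : set (option utree)) :
  A (s k) -> nbhs s [set s' : fringe_seq | A (s' k)].
Proof.
move=> As; have := @proj_continuous _ (fun=> discrete_topology (option utree)) k s A.
by apply; exact/principal_filterP.
Qed.

(** The coordinates are discrete, so a function of one coordinate is locally constant. *)
Lemma coord_continuous : continuous (fun s : fringe_seq => g (s k)).
Proof. by move=> s A gA; apply: (@nbhs_coord s (g @^-1` A)); exact: (nbhs_singleton gA). Qed.

Lemma coord_measurable : measurable_fun [set: borel fringe_seq]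
  (fun s : borel fringe_seq => g (s k)).
Proof.
move=> _ B mB; rewrite setTI; apply: sub_sigma_algebra.
by rewrite /= openE => s Bs; exact: (@nbhs_coord s (g @^-1` B)).
Qed.

Hypothesis g_ge0 : forall o, 0 <= g o.

Lemma Rintegral_Phi (t : utree) :
  \int[Phi R t]_s g (s k) =
  (gsize (utree_repr t))%:R^-1 * \sum_(v < gsize (utree_repr t)) g (spine v k).
Proof.
have r0 : (0 <= (gsize (utree_repr t))%:R^-1 :> R) by rewrite invr_ge0.
pose D (j : nat) : {measure set (borel fringe_seq) -> \bar R} :=
  @dirac _ (borel fringe_seq) (spine (odflt (groot (utree_repr t)) (insub j))) R.
rewrite /Rintegral (eq_measure_integral
  (mscale (NngNum r0) (msum D (gsize (utree_repr t))))); last first.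
  move=> A _ _; rewrite /Phi /mscale /msum /=; congr (_ * _)%E.
  by apply: eq_bigr => v _; rewrite /D valK.
have mg : measurable_fun [set: borel fringe_seq] (fun s : borel fringe_seq => (g (s k))%:E).
  by apply/measurable_EFinP; exact: coord_measurable.
rewrite ge0_integral_mscale//=; last by move=> s _; rewrite lee_fin.
rewrite ge0_integral_measure_sum//=; last by move=> s _; rewrite lee_fin.
under eq_bigr => v _ do rewrite /D valK integral_dirac// diracT mul1e.
by rewrite sumEFin.
Qed.

Definition coord_test (B : R) (gB : forall o, `|g o| <= B) : bounded_continuous R fringe_seq :=
  exist _ (fun s : fringe_seq => g (s k))
    (conj coord_continuous ((bounded_fun_exists _).2 (ex_intro _ B (fun s => gB (s k))))).

End CoordinateFunctionals.

(** A projection composed with the map that induces the weak topology. *)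
Lemma weak_prob_Rintegral_continuous (R : realType) (X : ptopologicalType)
    (F : bounded_continuous R X) :
  continuous (fun mu : weak_prob R X => \int[mu]_x sval F x).
Proof.
pose ev (mu : weak_prob R X) : {ptws bounded_continuous R X -> R} :=
  fun F' => \int[mu]_x sval F' x.
have ev_cont : continuous ev by exact: initial_continuous.
move=> mu; apply: (@continuous_comp _ _ _ ev (@proj _ (fun=> R) F)); first exact: ev_cont.
exact: (@proj_continuous _ (fun=> R) F).
Qed.

Section SimpleApproximation.
Import HBSimple.

(** Density of simple functions in L1, applied to the identity; this is where the finite mean of
    [nu] enters. The sum of all [|y|] over [vs] serves as [K]. *)
Lemma simple_approximation (R : realType) (nu : probability (measurableTypeR R) R) (eps : R) :
  nu.-integrable [set: R] (fun x : R => x%:E) -> 0 < eps ->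
  exists (phi : R -> R) vs (K : R),
    [/\ measurable_fun [set: R] phi, uniq vs, forall x, phi x \in vs,
        0 <= K /\ {in vs, forall y, `|y| <= K} &
        (\int[nu]_x (`|x - phi x|)%:E <= eps%:E)%E].
Proof.
move=> inu eps0.
have [g [_ _ gcvg]] := approximation_sfun_integrable measurableT inu.
have gfin : \forall n \near \oo,
    (\int[nu]_z (`|z%:E - (g n z)%:E|) <= eps%:E)%E.
  have := gcvg; move=> /fine_cvgP[nfin /cvgr0_norm_le/(_ eps eps0) nle].
  near=> n.
  rewrite -(fineK (near nfin n _))// lee_fin.
  by apply: le_trans (ler_norm _) _; near: n.
have [n gn] := filter_ex gfin.
pose vs : seq R := finmap.enum_fset (fset_set (range (g n))).
have gvs x : g n x \in vs.
  have /in_fset_set gE : finite_set (range (g n)) by exact: fimfunP.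
  by have := gE (g n x); rewrite /vs => ->; apply/mem_set; exists x.
exists (g n), vs, (\sum_(y <- vs) `|y|); split => //.
- move=> _ Y mY; exact: (measurable_funPT (g n) measurableT Y mY).
- exact: finmap.fset_uniq.
- split; first exact: sumr_ge0.
  move=> y yvs; rewrite (bigD1_seq y)//= ?finmap.fset_uniq//.
  by rewrite lerDl sumr_ge0.
Unshelve. all: by end_near. Qed.

End SimpleApproximation.

(** * Conditioning on the tree *)

Section Fibres.
Variables (R : realType) (d : measure_display) (Omega : measurableType d).
Variables (P : probability Omega R) (T : {RV P >-> borel tree_space}).
Local Notation fibre t := ((T : Omega -> utree) @^-1` [set t]).

Lemma measurable_fibre t : measurable (fibre t).
Proof.
rewrite -[X in measurable X]setTI; apply: (@measurable_funPT _ _ _ _ T) => //.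
by apply: sub_sigma_algebra; exact: discrete_open.
Qed.

Let block (k : nat) : set Omega := [set w | pickle (utree_repr (T w)) = k].

Let blockP k : block k = set0 \/ exists t, block k = fibre t.
Proof.
have [[t tk]|nt] := pselect (exists t, pickle (utree_repr t) = k); [right|left].
  exists t; apply/seteqP; split => w; last by move=> Tw; rewrite /block/= -tk -Tw.
  rewrite /block/= -tk => /(pcan_inj (@pickleK _)) h.
  exact: (can_inj (@reprK _ _) h).
by apply/seteqP; split => // w wk; apply: nt; exists (T w).
Qed.

Let bigcup_block : \bigcup_k block k = setT.
Proof. by apply/seteqP; split => // w _; exists (pickle (utree_repr (T w))). Qed.

Let measurable_block k : measurable (block k).
Proof.
have [->|[t ->]] := blockP k; first exact: measurable0.
exact: measurable_fibre.
Qed.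

Lemma measurable_fun_fibres d' (Y : measurableType d') (H : Omega -> Y) :
  (forall t, measurable_fun (fibre t) H) -> measurable_fun setT H.
Proof.
move=> mH; rewrite -bigcup_block; apply/measurable_fun_bigcup => // k.
have [->|[t ->]] := blockP k; last exact: mH.
exact: measurable_fun_set0.
Qed.

Lemma measurable_of_tree (C : utree -> R) : measurable_fun setT (fun w => C (T w)).
Proof.
apply: measurable_fun_fibres => t.
apply: (eq_measurable_fun (cst (C t))); last exact: measurable_cst.
by move=> w /set_mem Tw; rewrite /cst -Tw.
Qed.

(** Bounds given the tree are summed over the countably many fibres, on each of which [C (T w)] is
    constant. *)
Lemma le_integral_fibres (H : Omega -> R) (C : utree -> R) :
  (forall w, 0 <= H w) -> (forall t, 0 <= C t) ->
  (forall t, measurable_fun (fibre t) H) ->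
  (forall t, \int[P]_(w in fibre t) (H w)%:E <= P (fibre t) * (C t)%:E)%E ->
  (\int[P]_w (H w)%:E <= \int[P]_w (C (T w))%:E)%E.
Proof.
move=> H0 C0 mH HC.
have mC : measurable_fun setT (fun w => C (T w)) by exact: measurable_of_tree.
have mHT := measurable_fun_fibres mH.
have tb : trivIset setT block by move=> i j _ _ [w [/= <- <-]].
rewrite -bigcup_block !ge0_integral_bigcup//; last 4 first.
- by rewrite bigcup_block; exact/measurable_EFinP.
- by move=> w _; rewrite lee_fin.
- by rewrite bigcup_block; exact/measurable_EFinP.
- by move=> w _; rewrite lee_fin.
apply: lee_nneseries => [k _ _|k _]; first by apply: integral_ge0 => w _; rewrite lee_fin.
have [->|[t ->]] := blockP k; first by rewrite !integral_set0.
apply: (le_trans (HC t)).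
have CT : {in fibre t, (fun w => (C (T w))%:E) =1 cst (C t)%:E}.
  by move=> w /set_mem Tw; rewrite /cst -Tw.
rewrite (eq_integral _ _ CT) integral_cst; last exact: measurable_fibre.
by rewrite muleC.
Qed.

End Fibres.

Section OneTree.
Variables (R : realType) (nu : probability (measurableTypeR R) R).
Variables (phi : R -> R) (vs : seq R).
Hypothesis mphi : measurable_fun [set: R] phi.
Hypothesis vs_uniq : uniq vs.
Hypothesis phi_vs : forall x, phi x \in vs.
Variables (K delta : R).
Hypothesis K_ge0 : 0 <= K.
Hypothesis vsK : {in vs, forall y, `|y| <= K}.
Hypothesis phi_delta : (\int[nu]_x (`|x - phi x|)%:E <= delta%:E)%E.

Local Notation N t := ((gsize (utree_repr t))%:R : R).

Definition weight_density (Omega : Type) (T : Omega -> utree)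
    (X : forall t : utree, {set 'I_(gsize (utree_repr t))} -> Omega -> R) (w : Omega) : R :=
  (N (T w))^-1 * matching_weight (fun e => X (T w) e w).

Variables (d : measure_display) (Omega : measurableType d).
Variables (P : probability Omega R) (T : {RV P >-> borel tree_space}).
Variable X : forall t : utree, {set 'I_(gsize (utree_repr t))} -> Omega -> R.
Hypothesis X_iid : cond_iid_weights P nu (T : Omega -> utree) X.
Local Notation fibre t := ((T : Omega -> utree) @^-1` [set t]).

(* Weights off the edge set are unconstrained, hence possibly not measurable;
   they do not matter and are replaced by [0]. *)
Let edge_weight t (e : {set 'I_(gsize (utree_repr t))}) (w : Omega) : R :=
  if e \in gedges (utree_repr t) then X e w else 0.

Let measurable_edge_weight t e : measurable_fun (fibre t) (@edge_weight t e).
Proof.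
rewrite /edge_weight; case: (boolP (e \in _)) => [eE|_]; last exact: measurable_cst.
by have [/(_ e eE)[]] := X_iid t.
Qed.

Let weight_density_fibre t w : fibre t w -> weight_density T X w =
  (N t)^-1 * max_matching [set: 'I_(gsize (utree_repr t))]%SET (@edge_weight t ^~ w).
Proof.
move=> /= <-; rewrite /weight_density matching_weightE; congr (_ * _).
by apply: eq_max_matching => e eE _; rewrite /edge_weight eE.
Qed.

Let measurable_weight_density_fibre t : measurable_fun (fibre t) (weight_density T X).
Proof.
apply: (eq_measurable_fun (fun w => (N t)^-1 *
    max_matching [set: 'I_(gsize (utree_repr t))]%SET (@edge_weight t ^~ w))).
  by move=> w /set_mem wt; rewrite (weight_density_fibre wt).
apply: measurable_funM; first exact: measurable_cst.
by apply: measurable_max_matching; exact: measurable_edge_weight.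
Qed.

Lemma measurable_weight_density : measurable_fun setT (weight_density T X).
Proof. exact: measurable_fun_fibres measurable_weight_density_fibre. Qed.

Let rho := point_mass nu phi.

(** In order: the rounding error, the variance term, the slack from the fluctuation inequality, and
    the distance from the mean density to [c]. *)
Definition truncation_bound (eta c : R) (t : utree) : R :=
  delta + eta^-1 * ((2 * K) ^+ 2 * (N t)^-1) +
  (eta + Num.min 1 `|(N t)^-1 * mean_weight vs rho
     (max_matching (R := R) [set: 'I_(gsize (utree_repr t))]%SET) - c|).

Lemma delta_ge0 : 0 <= delta.
Proof. by rewrite -lee_fin; apply: le_trans phi_delta; apply: integral_ge0. Qed.

Lemma truncation_bound_ge0 (eta c : R) t : 0 < eta -> 0 <= truncation_bound eta c t.
Proof.
move=> eta0; rewrite /truncation_bound addr_ge0//.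
  by rewrite addr_ge0 ?delta_ge0// mulr_ge0 ?mulr_ge0 ?sqr_ge0// invr_ge0 ltW.
by rewrite addr_ge0 ?(ltW eta0)// le_min ler01 normr_ge0.
Qed.

Lemma integral_truncated_dist_le (eta c : R) : 0 < eta ->
  (\int[P]_w (Num.min 1 `|weight_density T X w - c|)%:E <=
   \int[P]_w (truncation_bound eta c (T w))%:E)%E.
Proof.
move=> eta0; apply: (@le_integral_fibres _ _ _ _ T _ (truncation_bound eta c)).
- by move=> w; rewrite le_min ler01 normr_ge0.
- by move=> t; exact: truncation_bound_ge0.
- move=> t; apply: measurable_minr; first exact: measurable_cst.
  apply: measurableT_comp => //; apply: measurable_funB; last exact: measurable_cst.
  exact: measurable_weight_density_fibre.
- move=> t.
  rewrite (eq_integral (fun w => (Num.min 1 `|(N t)^-1 *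
      max_matching [set: 'I_(gsize (utree_repr t))]%SET (@edge_weight t ^~ w) - c|)%:E)); last first.
    by move=> w /set_mem wt; rewrite (weight_density_fibre wt).
  apply: cond_truncated_dist_le => //.
  + exact: measurable_fibre.
  + move=> A mA; have [_ /(_ A mA) <-] := X_iid t.
    congr (P _); apply/seteqP; split => w [wt h]; split => // e eE; have := h e eE;
      by rewrite /edge_weight eE.
Qed.

End OneTree.

Lemma test_shape_continuous (R : realType) (T : topologicalType) (x y : T -> R)
    (a b b' c e k : R) : continuous x -> continuous y ->
  continuous (fun m => a + b * (b' * (c + x m)) + (e + Num.min 1 `|y m - k|)).
Proof.
move=> cx cy m; rewrite /continuous_at; apply: cvgD.
  apply: cvgD; first exact: cvg_cst.
  apply: cvgM; first exact: cvg_cst.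
  apply: cvgM; first exact: cvg_cst.
  by apply: cvgD; [exact: cvg_cst|exact: cx].
apply: cvgD; first exact: cvg_cst.
apply: (@continuous_min _ _ (fun=> 1) (fun m => `|y m - k|) m); first exact: cvg_cst.
apply: cvg_norm; apply: cvgB; [exact: cy|exact: cvg_cst].
Qed.

(** * Passage to the limit for simple weights *)

Section TruncatedLimit.
Variables (R : realType) (nu : probability (measurableTypeR R) R).
Variables (phi : R -> R) (vs : seq R).
Hypothesis mphi : measurable_fun [set: R] phi.
Hypothesis vs_uniq : uniq vs.
Hypothesis phi_vs : forall x, phi x \in vs.
Variables (K delta : R).
Hypothesis K_ge0 : 0 <= K.
Hypothesis vsK : {in vs, forall y, `|y| <= K}.
Hypothesis phi_delta : (\int[nu]_x (`|x - phi x|)%:E <= delta%:E)%E.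

Let rho := point_mass nu phi.
Let gain (o : option utree) : R := fringe_gain_opt vs rho o.
(** Integrated at coordinate [L] against [Phi], this is the proportion of vertices at depth less
    than [L]. *)
Let absent (o : option utree) : R := (o == None)%:R.

Let gain_bounds o : 0 <= gain o <= K.
Proof.
case: o => [t|] /=; last by rewrite lexx.
by apply: fringe_gain_bounds => //; [exact: point_mass_ge0|exact: sum_point_mass].
Qed.

Let norm_gain_le o : `|gain o| <= K.
Proof. by have /andP[g0 gK] := gain_bounds o; rewrite ger0_norm. Qed.

Let absent_bounds o : 0 <= absent o <= 1.
Proof. by rewrite /absent; case: (o == None); rewrite ?lexx ?ler01. Qed.

Let norm_absent_le o : `|absent o| <= 1.
Proof. by have /andP[g0 gK] := absent_bounds o; rewrite ger0_norm. Qed.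

(** A weakly continuous majorant of [truncation_bound]: the inverse number of vertices is replaced
    by [L.+1%:R^-1] plus the mass of [None] at coordinate [L], and the mean density by the integral
    of the gain. *)
Let test (eta c : R) (L : nat) (mu : weak_prob R fringe_seq) : R :=
  delta + eta^-1 * ((2 * K) ^+ 2 *
    (L.+1%:R^-1 + \int[mu]_s sval (coord_test L norm_absent_le) s)) +
  (eta + Num.min 1 `|\int[mu]_s sval (coord_test 0 norm_gain_le) s - c|).

Let test_continuous eta c L : continuous (test eta c L).
Proof.
apply: (@test_shape_continuous _ (weak_prob R fringe_seq)
  (fun mu => \int[mu]_s sval (coord_test L norm_absent_le) s)
  (fun mu => \int[mu]_s sval (coord_test 0 norm_gain_le) s));
  exact: weak_prob_Rintegral_continuous.
Qed.

Let absent_integral_bounds (mu : weak_prob R fringe_seq) L :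
  0 <= \int[mu]_s sval (coord_test L norm_absent_le) s <= 1.
Proof.
apply/andP; split.
  by apply: Rintegral_ge0 => s _; have /andP[] := absent_bounds (s L).
have iabsent : mu.-integrable setT (EFin \o (fun s : borel fringe_seq => absent (s L))).
  apply: (@integrable_bounded _ _ _ _ _ 1) => //; exact: coord_measurable.
have mu1 : \int[mu]_s (1 : R) = 1.
  by rewrite Rintegral_cst// [X in fine X](probability_setT mu) mulr1.
rewrite -[leRHS]mu1; apply: le_Rintegral => //.
  by apply: (@integrable_bounded _ _ _ _ _ 1) => // s; rewrite normr1.
by move=> s _; have /andP[] := absent_bounds (s L).
Qed.

Let test_bounded eta c L : 0 < eta -> bounded_fun (test eta c L).
Proof.
move=> eta0; apply/bounded_fun_exists.
exists (delta + eta^-1 * ((2 * K) ^+ 2 * (L.+1%:R^-1 + 1)) + (eta + 1)).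
move=> mu; have /andP[a0 a1] := absent_integral_bounds mu L.
have e0 : 0 <= eta^-1 by rewrite invr_ge0 ltW.
have L0 : 0 <= L.+1%:R^-1 :> R by rewrite invr_ge0.
have d0 := delta_ge0 phi_delta.
rewrite ger0_norm /test.
  rewrite !lerD ?ge_min ?lexx//.
  by rewrite ler_wpM2l// ler_wpM2l ?sqr_ge0// lerD.
rewrite addr_ge0//.
  by rewrite addr_ge0// mulr_ge0// mulr_ge0 ?sqr_ge0// addr_ge0.
by rewrite addr_ge0 ?(ltW eta0)// le_min ler01 normr_ge0.
Qed.

Let truncation_bound_le_test eta c L t : 0 < eta ->
  truncation_bound nu phi vs K delta eta c t <=
  test eta c L (Phi R t : probability (borel fringe_seq) R).
Proof.
move=> eta0; rewrite /truncation_bound /test /=.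
have e0 : 0 <= eta^-1 by rewrite invr_ge0 ltW.
have n0 : (0 < gsize (utree_repr t))%N by exact: gsize_gt0.
rewrite (Rintegral_Phi 0 (fun o => proj1 (andP (gain_bounds o)))).
rewrite -mean_max_matching; last exact: sum_point_mass.
rewrite lerD2r lerD2l ler_wpM2l// ler_wpM2l ?sqr_ge0//.
(* A tree with more than [L] vertices has inverse size at most [L.+1%:R^-1]; in a smaller one every
   spine is [None] at [L], so the mass is 1. *)
have [Lt|tL] := ltnP L (gsize (utree_repr t)).
  apply: (@le_trans _ _ L.+1%:R^-1).
    by rewrite lef_pV2 ?posrE ?ltr0n// ler_nat.
  rewrite lerDl; have /andP[] // := absent_integral_bounds
    (Phi R t : probability (borel fringe_seq) R) L.
rewrite (Rintegral_Phi L (fun o => proj1 (andP (absent_bounds o)))).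
under eq_bigr => v _ do rewrite spine_None// /absent eqxx.
rewrite sumr_const card_ord mulVf ?pnatr_eq0 -?lt0n//.
apply: (@le_trans _ _ 1); first by rewrite invf_le1 ?ltr0n// ler1n.
by rewrite lerDr invr_ge0.
Qed.

Variables (d0 : measure_display) (Omega0 : measurableType d0).
Variables (P0 : probability Omega0 R) (S : {RV P0 >-> borel sin_tree}).

Definition limit_gain : R :=
  \int[sin_tree_law S]_s fringe_gain_opt vs rho (s 0).

(** A sin-tree never takes the value [None], and centring at [limit_gain] cancels the last
    distance. *)
Let test_limit eta L : test eta limit_gain L (sin_tree_law S) =
  delta + eta^-1 * ((2 * K) ^+ 2 * L.+1%:R^-1) + eta.
Proof.
rewrite /test /= -/limit_gain subrr normr0 (min_r ler01) addr0.
suff -> : \int[sin_tree_law S]_s absent (s L) = 0 by rewrite addr0.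
rewrite /Rintegral ge0_integral_distribution//; last 2 first.
- by apply/measurable_EFinP; exact: (coord_measurable (R := R) absent L).
- by move=> s; rewrite lee_fin; have /andP[] := absent_bounds (s L).
rewrite ge0_integral_distribution//; last first.
  apply: measurableT_comp; last exact: sin_tree_incl_measurable.
  by apply/measurable_EFinP; exact: (coord_measurable (R := R) absent L).
by rewrite integral0_eq.
Qed.

Variables (d : nat -> measure_display) (Omega : forall n, measurableType (d n)).
Variables (P : forall n, probability (Omega n) R).
Variable T : forall n, {RV (P n) >-> borel tree_space}.
Variable X : forall (n : nat) (t : utree), {set 'I_(gsize (utree_repr t))} -> Omega n -> R.
Hypothesis T_cvg : cvg_fringe P (fun n => T n : Omega n -> utree) S.
Hypothesis X_iid : forall n, cond_iid_weights (P n) nu (T n) (@X n).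

Lemma tdist_limit_gain (eps : R) : 0 < eps ->
  \forall n \near \oo, tdist P (fun n => weight_density (T n) (@X n)) n limit_gain <= delta + eps.
Proof.
move=> eps0; pose eta := eps / 4.
have eta0 : 0 < eta by rewrite divr_gt0.
(* [L] is chosen from this threshold so that the variance term is at most [eta]; the added 1 covers
   [K = 0]. With the slack and the convergence error the total is at most [3 * eta], below [eps]. *)
have C0 : 0 < eta ^+ 2 / ((2 * K) ^+ 2 + 1).
  by rewrite divr_gt0 ?exprn_gt0// ltr_pwDr ?sqr_ge0.
have [L _ LC] := near_infty_natSinv_lt (PosNum C0).
have {}LC : L.+1%:R^-1 < eta ^+ 2 / ((2 * K) ^+ 2 + 1) := LC L (leqnn L).
have := T_cvg (@test_continuous eta limit_gain L) (@test_bounded eta limit_gain L eta0).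
rewrite test_limit => test_cvg.
near=> n.
have test_n : \int[P n]_w
    test eta limit_gain L (Phi R (T n w) : probability (borel fringe_seq) R) <=
    delta + eta^-1 * ((2 * K) ^+ 2 * L.+1%:R^-1) + eta + eta.
  rewrite -lerBlDl; apply: le_trans (ler_norm _) _; rewrite distrC.
  by near: n; exact: cvgr_dist_le.
apply: (@le_trans _ _ (delta + eta^-1 * ((2 * K) ^+ 2 * L.+1%:R^-1) + eta + eta)); last first.
  have : eta^-1 * ((2 * K) ^+ 2 * L.+1%:R^-1) <= eta.
    rewrite -ler_pdivlMl ?invr_gt0// invrK -expr2.
    move: LC; rewrite ltr_pdivlMr; last by rewrite ltr_pwDr ?sqr_ge0.
    rewrite mulrC mulrDl mul1r => /ltW; apply: le_trans.
    by rewrite lerDl invr_ge0.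
  have -> : eps = 4 * eta by rewrite /eta mulrC divfK.
  by move: (eta^-1 * _) => y; lra.
apply: le_trans test_n.
pose testT w := test eta limit_gain L (Phi R (T n w) : probability (borel fringe_seq) R).
have mtest : measurable_fun setT testT.
  exact: (measurable_of_tree (T n)
    (fun t => test eta limit_gain L (Phi R t : probability (borel fringe_seq) R))).
have [B testB] := (bounded_fun_exists _).1 (@test_bounded eta limit_gain L eta0).
have itest : (P n).-integrable setT (EFin \o testT).
  by apply: (@integrable_bounded _ _ _ _ testT B) => // w; exact: testB.
have mdist : measurable_fun setT (fun w => Num.min 1 `|weight_density (T n) (@X n) w - limit_gain|).
  apply: measurable_minr; first exact: measurable_cst.
  apply: measurableT_comp => //; apply: measurable_funB; last exact: measurable_cst.
  exact: measurable_weight_density.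
have idist : (P n).-integrable setT
    (EFin \o (fun w => Num.min 1 `|weight_density (T n) (@X n) w - limit_gain|)).
  apply: (@integrable_bounded _ _ _ _ _ 1) => // w.
  by rewrite ger0_norm ?ge_min ?lexx// le_min ler01 normr_ge0.
apply: fine_le; [exact: integrable_fin_num|exact: integrable_fin_num|].
apply: (le_trans (integral_truncated_dist_le mphi vs_uniq phi_vs K_ge0 vsK phi_delta
  (@X_iid n) _ eta0)).
apply: ge0_le_integral => //.
- by move=> w _; rewrite lee_fin; apply: truncation_bound_ge0.
- by apply/measurable_EFinP; exact: measurable_of_tree.
- exact/measurable_EFinP.
- by move=> w _; rewrite lee_fin; exact: truncation_bound_le_test.
Unshelve. all: by end_near. Qed.

End TruncatedLimit.

Theorem theorem4p7 (R : realType)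
    (d0 : measure_display) (Omega0 : measurableType d0)
    (P0 : probability Omega0 R) (S : {RV P0 >-> borel sin_tree})
    (nu : probability (measurableTypeR R) R)
    (nu_ge0 : nu [set x : R | x < 0] = 0%E)
    (nu_fin : nu.-integrable [set: R] (fun x : R => x%:E)) :
  exists c : R,
    forall (d : nat -> measure_display) (Omega : forall n, measurableType (d n))
      (P : forall n, probability (Omega n) R)
      (T : forall n, {RV (P n) >-> borel tree_space})
      (X : forall (n : nat) (t : utree),
         {set 'I_(gsize (utree_repr t))} -> Omega n -> R),
      cvg_fringe P (fun n => T n : Omega n -> utree) S ->
      (forall n, cond_iid_weights (P n) nu (T n) (X n)) ->
      cvg_in_distribution_cst P
        (fun n w => (gsize (utree_repr (T n w)))%:R^-1 *
                    matching_weight (fun e => X n (T n w) e w)) c.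
Proof.
have k0 (k : nat) : 0 < k.+1%:R^-1 :> R by rewrite invr_gt0.
(* The roundings, with error [k.+1%:R^-1], are fixed before the trees and weights are introduced, so
   the constant depends only on [nu] and the law of [S]. *)
pose approx k := simple_approximation nu_fin (k0 k).
have [phi phiP] := choice approx.
have [vs vsP] := choice phiP.
(* That this limit exists is derived in [cvg_in_distribution_lim] from the random variables that all
   its terms approximate. *)
exists (lim ((fun k => limit_gain nu (phi k) (vs k) S) @ \oo)) => d Omega P T X T_cvg X_iid.
apply: cvg_in_distribution_lim => [n|k eps eps0].
  exact: measurable_weight_density (X_iid n).
have [K [mphi vs_uniq phi_vs [K_ge0 vsK] phi_delta]] := vsP k.
exact: (tdist_limit_gain mphi vs_uniq phi_vs K_ge0 vsK phi_delta T_cvg X_iid eps0).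
Qed.
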